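(* There exist absolute constants $C_1, C_2<\infty$ such that the following holds. Let $b$ be a symbol on $\mathbb R^2$ such that for all $I,J\in\mathcal D$ $$(b, h_I\otimes h_J)\neq 0 \ \Longrightarrow\ I \text{ and } J \text{ are both even}.$$ Then for every dyadic open set $U_0\subset\mathbb R^2$, $$\sum_{I\times J\subset U_0} (b, h_I\otimes h_J)^2 \le C_1 \|\mathcal T^b\|^2\,|U_0| + C_2 \|b\|_{BMO_r}^2\,|U_0|,$$ where the sum is over all dyadic rectangles $I\times J\in\mathcal D\times\mathcal D$ contained in $U_0$.
   Context: $\mathcal D$ is the usual dyadic lattice on $\mathbb R$; $\mathcal D\times\mathcal D$ is the family of dyadic rectangles $R=I\times J$ in $\mathbb R^2$. For $I\in\mathcal D$, $I_+$ and $I_-$ are its right and left halves, and $h_I=|I|^{-1/2}(\mathbf 1_{I_+}-\mathbf 1_{I_-})$ is the Haar function; $(h_I\otimes h_J)(x,y)=h_I(x)h_J(y)$. $(\cdot,\cdot)$ is the $L^2$ pairing, $|\cdot|$ is Lebesgue measure. An interval $I\in\mathcal D$ is called even if $|I|=2^{-2k}$ for some integer $k$, and odd otherwise. The dyadic shift $T_1$ acts on functions of the variable $x$ by $T_1h_I=h_{I_+}-h_{I_-}$ if $I$ is even and $T_1h_I=0$ otherwise (extended linearly and boundedly to $L^2$). $T_2$ is the copy of $T_1$ acting in the variable $y$. Both are regarded as operators on $L^2(\mathbb R^2)$, each acting in its own variable only. A symbol $b$ is a real-valued function in $L^2_{loc}(\mathbb R^2)$, and $b$ also denotes the operator of multiplication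 by $b$. The repeated commutator is $$\mathcal T^b=[T_2,[T_1,b]]=T_2T_1b-T_2bT_1-T_1bT_2+bT_1T_2,$$ defined on finite linear combinations of the functions $h_I\otimes h_J$; $\|\mathcal T^b\|$ is its operator norm $L^2(\mathbb R^2)\to L^2(\mathbb R^2)$ ($+\infty$ if it is not bounded). A dyadic open set is a finite union of dyadic rectangles. The (dyadic) rectangular BMO norm is $$\|b\|_{BMO_r}^2=\sup_{I_0,J_0\in\mathcal D}\frac{1}{|I_0||J_0|}\sum_{I\subseteq I_0,\,J\subseteq J_0}|(b,h_I\otimes h_J)|^2$$ (sum over $I,J\in\mathcal D$). *)

(* Defs.v *)
From HB Require Import structures.
From mathcomp Require Import all_boot all_order all_algebra.
From mathcomp Require Import all_classical all_reals all_analysis.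
Set Implicit Arguments.
Unset Strict Implicit.
Unset Printing Implicit Defensive.
Import Order.TTheory GRing.Theory Num.Theory.
Import numFieldNormedType.Exports.
Local Open Scope classical_set_scope.
Local Open Scope ring_scope.

(* The pair (k, m) stands for the dyadic interval [m 2^-k, (m + 1) 2^-k[.
   This encoding of the dyadic lattice is bijective, so sums over dyadic
   intervals are sums over such pairs. *)
Definition dyadic : Type := (int * int)%type.

Definition dyadic_length (R : realType) (I : dyadic) : R := 2 ^ (- I.1).

Definition dyadic_set (R : realType) (I : dyadic) : set R :=
  `[I.2%:~R * dyadic_length R I, (I.2 + 1)%:~R * dyadic_length R I[%classic.
Arguments dyadic_set R I : clear implicits.

Definition left_half (I : dyadic) : dyadic := (I.1 + 1, 2 * I.2).
Definition right_half (I : dyadic) : dyadic := (I.1 + 1, 2 * I.2 + 1).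

Definition even_dyadic (R : realType) (I : dyadic) : Prop :=
  exists k : int, dyadic_length R I = 2 ^ (- (2 * k)).

Definition haar (R : realType) (I : dyadic) (x : R) : R :=
  (Num.sqrt (dyadic_length R I))^-1 *
  (\1_(dyadic_set R (right_half I)) x - \1_(dyadic_set R (left_half I)) x).

Definition tensor (R : realType) (f g : R -> R) (z : R * R) : R :=
  f z.1 * g z.2.

Definition plane_measure (R : realType) :
    {measure set (measurableTypeR R * measurableTypeR R) -> \bar R} :=
  (@lebesgue_measure R \x @lebesgue_measure R)%E.

Definition dyadic_rect (R : realType) (Q : dyadic * dyadic) : set (R * R) :=
  dyadic_set R Q.1 `*` dyadic_set R Q.2.
Arguments dyadic_rect R Q : clear implicits.

Definition dyadic_open (R : realType) (U : set (R * R)) : Prop :=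
  exists s : seq (dyadic * dyadic),
    U = \bigcup_(Q in [set` s]) dyadic_rect R Q.

(* Elements of L^2 are represented by functions, so linearity is required
   almost everywhere; together with boundedness it makes T compatible with
   almost everywhere equality. Nothing is said about T outside L^2. *)
Definition bounded_linear_L2 d (X : measurableType d) (R : realType)
    (mu : {measure set X -> \bar R}) (T : (X -> R) -> X -> R) : Prop :=
  [/\ forall f, f \in Lfun mu 2%:E -> T f \in Lfun mu 2%:E,
      forall (a : R) f g, f \in Lfun mu 2%:E -> g \in Lfun mu 2%:E ->
        {ae mu, forall x, T (fun y => a * f y + g y) x = a * T f x + T g x}
    & exists C : R, forall f, f \in Lfun mu 2%:E ->
        ('N[mu]_2%:E[EFin \o T f] <= C%:E * 'N[mu]_2%:E[EFin \o f])%E].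

(* These three predicates determine S, T1 and T2 up to almost everywhere
   equality, because Haar functions span a dense subspace of L^2(R) and
   elementary tensors span a dense subspace of L^2(R^2). *)
Definition dyadic_shift (R : realType) (S : (R -> R) -> R -> R) : Prop :=
  [/\ bounded_linear_L2 (@lebesgue_measure R) S,
      forall I, even_dyadic R I ->
        {ae @lebesgue_measure R, forall x,
          S (haar I) x = haar (right_half I) x - haar (left_half I) x}
    & forall I, ~ even_dyadic R I ->
        {ae @lebesgue_measure R, forall x, S (haar I) x = 0}].

Definition acting_in_x (R : realType) (S : (R -> R) -> R -> R)
    (T : (R * R -> R) -> R * R -> R) : Prop :=
  bounded_linear_L2 (plane_measure R) T /\
  forall f g, f \in Lfun (@lebesgue_measure R) 2%:E ->
    g \in Lfun (@lebesgue_measure R) 2%:E ->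
    {ae plane_measure R, forall z, T (tensor f g) z = tensor (S f) g z}.

Definition acting_in_y (R : realType) (S : (R -> R) -> R -> R)
    (T : (R * R -> R) -> R * R -> R) : Prop :=
  bounded_linear_L2 (plane_measure R) T /\
  forall f g, f \in Lfun (@lebesgue_measure R) 2%:E ->
    g \in Lfun (@lebesgue_measure R) 2%:E ->
    {ae plane_measure R, forall z, T (tensor f g) z = tensor f (S g) z}.

Definition symbol (R : realType) (b : R * R -> R) : Prop :=
  measurable_fun [set: measurableTypeR R * measurableTypeR R] b /\
  forall K : set (R * R), compact K ->
    (\int[plane_measure R]_(z in K) (b z ^+ 2)%:E < +oo)%E.

Definition haar_coef (R : realType) (b : R * R -> R) (I J : dyadic) : R :=
  \int[plane_measure R]_z (b z * tensor (haar I) (haar J) z).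

Definition haar_span (R : realType) : set (R * R -> R) :=
  [set f | exists s : seq (R * (dyadic * dyadic)),
    f = fun z => \sum_(t <- s) t.1 * tensor (haar t.2.1) (haar t.2.2) z].

Definition repeated_commutator (R : realType)
    (T1 T2 : (R * R -> R) -> R * R -> R) (b f : R * R -> R) : R * R -> R :=
  T2 (T1 (b \* f)) \- T2 (b \* T1 f) \- T1 (b \* T2 f) \+ b \* T1 (T2 f).

Definition commutator_norm (R : realType)
    (T1 T2 : (R * R -> R) -> R * R -> R) (b : R * R -> R) : \bar R :=
  ereal_sup
    [set 'N[plane_measure R]_2%:E[EFin \o repeated_commutator T1 T2 b f]%E
      | f in [set f | haar_span f /\
                      ('N[plane_measure R]_2%:E[EFin \o f] <= 1)%E]].

Definition BMOr_norm_sq (R : realType) (b : R * R -> R) : \bar R :=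
  ereal_sup (range (fun Q0 : dyadic * dyadic =>
    ((dyadic_length R Q0.1 * dyadic_length R Q0.2)^-1%:E *
     \esum_(Q in [set Q : dyadic * dyadic |
         dyadic_set R Q.1 `<=` dyadic_set R Q0.1 /\
         dyadic_set R Q.2 `<=` dyadic_set R Q0.2])
       (haar_coef b Q.1 Q.2 ^+ 2)%:E)%E)).

(* Main.v *)
Require Import Defs.
From mathcomp Require Import all_boot all_order all_algebra.
From mathcomp Require Import all_classical all_reals all_analysis.
From mathcomp Require Import measurable_realfun ring lra zify.
Set Implicit Arguments.
Unset Strict Implicit.
Unset Printing Implicit Defensive.
Import Order.TTheory GRing.Theory Num.Theory.
Import numFieldNormedType.Exports.
Local Open Scope classical_set_scope.
Local Open Scope ring_scope.

(** The Haar coefficients of b can be read off from the values of the repeated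
commutator on one test function. Write s_K for the shift of h_K. If f is a
finite Haar sum equal to 1 on a product I x J of even intervals, then
  (T^b f, s_I (x) s_J) = 4 (b, h_I (x) h_J)          (lemma commutator_coef).
The functions s_I (x) s_J with I and J even are orthogonal, of squared norm 4,
so Bessel's inequality bounds four times the sum of the squares of the
coefficients over the rectangles on which f = 1 by the squared norm of T^b f
(finite_sum_le). For a dyadic open set U there is such an f, equal to 1 on all
of U, with squared norm 4 |U| (test_function). Hence the sum over the rectangles
in U is at most |U| times the squared norm of T^b; the constants are 1 and 0.

Why the identity holds. The adjoint of the shift sends s_I to 2 h_I for I even
(shift_adjoint, x_adjoint, y_adjoint), so
  (T^b (h_K (x) h_L), s_I (x) s_J) = int b (w_K (x) w_L)
with w_K = 2 h_K h_I - s_K s_I and likewise in the second variable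
(commutator_pairing). When K differs from I, s_K s_I is a combination of Haar
functions of odd intervals, to which b is orthogonal; when K = I the two squares
cancel and w_K = 0. Thus only the products h_K h_I with K <> I survive, and for
f = sum c_KL h_K (x) h_L the pairing is four times the integral of b against
  sum_(K <> I, L <> J) c_KL h_K h_I (x) h_L h_J.
The terms left out, K = I or L = J, are Haar coefficients of f in one variable,
which vanish over I x J because f is constant there. So the last sum equals
f (h_I (x) h_J) = h_I (x) h_J. Only finite Haar sums occur: b is never expanded.

The analytic input is that the adjoint formulas hold on all of L2, because b f
is a general L2 function. This is the density of the Haar system
(haar_complete) and of elementary tensors (plane_L2functional_eq0), both
obtained from a Dynkin class argument for bounded functionals
(L2functional_eq0). *)

(** * The real L2 pairing and bounded functionals *)

Section ip.
Context d (T : measurableType d) (R : realType) (mu : {measure set T -> \bar R}).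
Implicit Types f g h : T -> R.
Local Notation L2 := (Lfun mu 2%:E).

Lemma ae_imp (P Q : T -> Prop) : (forall x, P x -> Q x) ->
  {ae mu, forall x, P x} -> {ae mu, forall x, Q x}.
Proof. exact: filterS. Qed.

Lemma ae_imp2 (P1 P2 Q : T -> Prop) : (forall x, P1 x -> P2 x -> Q x) ->
  {ae mu, forall x, P1 x} -> {ae mu, forall x, P2 x} -> {ae mu, forall x, Q x}.
Proof. exact: filterS2. Qed.

Definition ip f g : R := \int[mu]_x (f x * g x).

Lemma L2_measurable f : f \in L2 -> measurable_fun setT f.
Proof. by rewrite inE => /andP[]; rewrite inE. Qed.

Lemma L2_square_integrable f : measurable_fun setT f ->
  (\int[mu]_x (f x ^+ 2)%:E < +oo)%E -> f \in L2.
Proof.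
move=> mf foo; rewrite inE; apply/andP; split; rewrite inE//=.
rewrite /finite_norm unlock /Lnorm poweR_lty//.
rewrite (eq_integral (fun x => (f x ^+ 2)%:E))// => x _.
by rewrite poweR_EFin/= powR_mulrn// real_normK// num_real.
Qed.

Lemma L2_lin a f g : f \in L2 -> g \in L2 -> (fun x => a * f x + g x) \in L2.
Proof. by move=> fL gL; have [_] := Lfun_submod_closed mu (lee1n 2); exact. Qed.

Lemma L2_0 : (fun=> 0) \in L2.
Proof. by have [] := Lfun_submod_closed mu (lee1n 2). Qed.

Lemma L2_Z a f : f \in L2 -> (fun x => a * f x) \in L2.
Proof.
move=> fL; have := L2_lin a fL L2_0.
by under eq_fun do rewrite addr0.
Qed.

Lemma L2_integrable f g : f \in L2 -> g \in L2 ->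
  mu.-integrable setT (EFin \o (fun x => f x * g x)).
Proof. by move=> fL gL; apply/Lfun1_integrable; exact: Lfun2_mul_Lfun1. Qed.

Lemma ip_linear a f g h : f \in L2 -> g \in L2 -> h \in L2 ->
  ip (fun x => a * f x + g x) h = a * ip f h + ip g h.
Proof.
move=> fL gL hL; rewrite /ip.
rewrite -RintegralZl//; last exact: L2_integrable.
rewrite -RintegralD//.
- by apply: eq_Rintegral => x _; ring.
- by have := L2_integrable (L2_Z a fL) hL; apply: eq_integrable => // x _ /=;
  rewrite mulrA.
- exact: L2_integrable.
Qed.

Lemma ipC f g : ip f g = ip g f.
Proof. by apply: eq_Rintegral => x _; rewrite mulrC. Qed.

Lemma ip0 h : ip (fun=> 0) h = 0.
Proof.
rewrite /ip; under eq_Rintegral do rewrite mul0r.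
by rewrite /Rintegral integral0.
Qed.

Lemma ip_ge0 f : 0 <= ip f f.
Proof. by apply: Rintegral_ge0 => x _; rewrite -expr2 sqr_ge0. Qed.

Lemma ip_Z a f h : f \in L2 -> h \in L2 -> ip (fun x => a * f x) h = a * ip f h.
Proof.
move=> fL hL; have := ip_linear a fL L2_0 hL; rewrite ip0 addr0.
by under eq_fun do rewrite addr0.
Qed.

Lemma ip_cauchy_schwarz f g : f \in L2 -> g \in L2 ->
  ip f g ^+ 2 <= ip f f * ip g g.
Proof.
move=> fL gL.
have P a : 0 <= a ^+ 2 * ip f f + 2 * a * ip f g + ip g g.
  have /= := ip_ge0 (fun x => a * f x + g x).
  rewrite ip_linear//; last exact: L2_lin.
  by rewrite ![ip _ (fun x => _ + _)]ipC !ip_linear// (ipC g f);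
    congr (0 <= _); ring.
have := ip_ge0 f; rewrite le_eqVlt => /predU1P[f0|f0]; last first.
  have := P (- ip f g / ip f f).
  set u := ip f g; set v := ip f f in f0 *; set w := ip g g => H.
  have : 0 <= v * ((- u / v) ^+ 2 * v + 2 * (- u / v) * u + w).
    by rewrite mulr_ge0// ltW.
  have -> : v * ((- u / v) ^+ 2 * v + 2 * (- u / v) * u + w) = v * w - u ^+ 2.
    by field; rewrite gt_eqF.
  by rewrite subr_ge0.
rewrite -f0 mul0r.
have [->|u0] := eqVneq (ip f g) 0; first by rewrite expr0n.
have := P (- (ip g g + 1) / (2 * ip f g)).
rewrite -f0 mulr0 add0r.
have -> : 2 * (- (ip g g + 1) / (2 * ip f g)) * ip f g + ip g g = -1 by field.
by rewrite oppr_ge0 ler10.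
Qed.

(** The operators of the theorem are only known up to almost everywhere
   equality; this is how such equalities enter pairings. *)
Lemma ip_aeq f f' g : f \in L2 -> f' \in L2 -> g \in L2 ->
  {ae mu, forall x, f x = f' x} -> ip f g = ip f' g.
Proof.
move=> fL fL' gL ff'; congr fine; apply: ae_eq_integral => //.
- by apply/measurable_EFinP; apply: measurable_funM; exact: L2_measurable.
- by apply/measurable_EFinP; apply: measurable_funM; exact: L2_measurable.
- by move: ff'; apply: filterS => x + _ => /= ->.
Qed.

Lemma ip_EFin f : f \in L2 -> (\int[mu]_x (f x ^+ 2)%:E)%E = (ip f f)%:E.
Proof.
move=> fL; rewrite /ip /Rintegral fineK; last first.
  by apply: integrable_fin_num => //; exact: L2_integrable.
by apply: eq_integral => x _; rewrite expr2.
Qed.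

Lemma Lnorm_ip f : f \in L2 -> ('N[mu]_2%:E[EFin \o f] =
  (Num.sqrt (ip f f))%:E)%E.
Proof.
move=> fL; rewrite unlock /Lnorm.
rewrite (eq_integral (fun x => (f x ^+ 2)%:E)); last first.
  by move=> x _; rewrite poweR_EFin/= powR_mulrn// real_normK// num_real.
by rewrite ip_EFin// poweR_EFin -powR12_sqrt// ip_ge0.
Qed.

Lemma bounded_ip (S : (T -> R) -> T -> R) : bounded_linear_L2 mu S ->
  exists2 C, 0 <= C & forall f, f \in L2 -> ip (S f) (S f) <= C * ip f f.
Proof.
move=> [SL _ [C SC]]; exists (C ^+ 2); first exact: sqr_ge0.
move=> f fL; have := SC f fL; rewrite !Lnorm_ip// ?SL// lee_fin => h.
rewrite -[ip (S f) _]sqr_sqrtr ?ip_ge0// -[ip f _]sqr_sqrtr ?ip_ge0// -exprMn.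
by rewrite ler_pXn2r// ?nnegrE ?sqrtr_ge0// (le_trans _ h)// sqrtr_ge0.
Qed.

Lemma ip_eq0 f : f \in L2 -> ip f f = 0 -> {ae mu, forall x, f x = 0}.
Proof.
move=> fL f0.
have : ('N[mu]_2%:E[EFin \o f] = 0)%E by rewrite Lnorm_ip// f0 sqrtr0.
have p2 : (0 < 2%:E :> \bar R)%E by rewrite lte_fin ltr0n.
move/(Lnorm_eq0_eq0 (proj2 (measurable_EFinP _ _) (L2_measurable fL)) p2).
by apply: ae_imp => x /(_ I) [].
Qed.

Lemma bounded_aeq (S : (T -> R) -> T -> R) f g : bounded_linear_L2 mu S ->
  f \in L2 -> g \in L2 -> {ae mu, forall x, f x = g x} ->
  {ae mu, forall x, S f x = S g x}.
Proof.
move=> bS fL gL fg; have [SL Slin _] := bS; have [C C0 bC] := bounded_ip bS.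
pose h := fun x => -1 * f x + g x.
have hL : h \in L2 by exact: L2_lin.
have h0 : ip h h = 0.
  rewrite -(ip0 h); apply: ip_aeq => //; first exact: L2_0.
  by apply: ae_imp fg => x /= fgx; rewrite /h fgx; ring.
have Sh0 : ip (S h) (S h) = 0.
  by apply/eqP; rewrite eq_le ip_ge0 (le_trans (bC _ hL))// h0 mulr0.
apply: ae_imp2 (ip_eq0 (SL _ hL) Sh0) (Slin (-1) f g fL gL) => x /= e1.
by rewrite e1 => /eqP; rewrite mulN1r eq_sym addrC subr_eq0 => /eqP.
Qed.

Lemma bounded_0 (S : (T -> R) -> T -> R) : bounded_linear_L2 mu S ->
  {ae mu, forall x, S (fun=> 0) x = 0}.
Proof.
move=> bS; have [SL _ _] := bS; have [C C0 bC] := bounded_ip bS.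
apply: ip_eq0; first exact: SL L2_0.
by apply/eqP; rewrite eq_le ip_ge0 (le_trans (bC _ L2_0))// ip0 mulr0.
Qed.

Lemma L2_aeq f g : f \in L2 -> measurable_fun setT g ->
  {ae mu, forall x, g x = f x} -> g \in L2.
Proof.
move=> fL mg gf; apply: L2_square_integrable => //.
suff -> : (\int[mu]_x (g x ^+ 2)%:E = \int[mu]_x (f x ^+ 2)%:E)%E.
  by rewrite ip_EFin// ltry.
have mf := L2_measurable fL; apply: ae_eq_integral => //.
- by apply/measurable_EFinP; exact: measurable_funX.
- by apply/measurable_EFinP; exact: measurable_funX.
- by apply: ae_imp gf => x /= ->.
Qed.

(** Boundedness is stated with squares because that is the form in which
   Cauchy-Schwarz delivers it. *)
Definition L2functional (F : (T -> R) -> R) :=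
  (forall a f g, f \in L2 -> g \in L2 ->
     F (fun x => a * f x + g x) = a * F f + F g) /\
  exists2 C, 0 <= C & forall f, f \in L2 -> F f ^+ 2 <= C * ip f f.

Lemma L2functional_op (S : (T -> R) -> T -> R) e : bounded_linear_L2 mu S ->
  e \in L2 -> L2functional (fun f => ip (S f) e).
Proof.
move=> bS eL; have [SL Slin _] := bS; have [C C0 bC] := bounded_ip bS; split.
  move=> a f g fL gL; rewrite -ip_linear ?SL//; apply: ip_aeq => //.
  - by apply: SL; exact: L2_lin.
  - by apply: L2_lin; exact: SL.
  - exact: Slin.
exists (C * ip e e); first by rewrite mulr_ge0 ?ip_ge0.
move=> f fL; apply: (le_trans (ip_cauchy_schwarz (SL _ fL) eL)).
by rewrite mulrAC ler_wpM2r ?ip_ge0 ?bC.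
Qed.

Lemma L2functional_ip e : e \in L2 -> L2functional (fun f => ip f e).
Proof.
move=> eL; split=> [a f g fL gL|]; first by rewrite ip_linear.
by exists (ip e e); [exact: ip_ge0|move=> f fL; rewrite mulrC;
  exact: ip_cauchy_schwarz].
Qed.

Lemma L2functional_sub a F G : L2functional F -> L2functional G ->
  L2functional (fun f => F f - a * G f).
Proof.
move=> [linF [C C0 FC]] [linG [D D0 GD]]; split.
  by move=> c f g fL gL; rewrite linF// linG//; ring.
exists (2 * C + 2 * a ^+ 2 * D).
  by apply: addr_ge0; do ?[exact: sqr_ge0 | apply: mulr_ge0].
move=> f fL; have h1 := FC f fL; have h2 := GD f fL.
have h3 : a ^+ 2 * G f ^+ 2 <= a ^+ 2 * (D * ip f f).
  by rewrite ler_wpM2l ?sqr_ge0.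
have h4 : 0 <= (F f + a * G f) ^+ 2 by exact: sqr_ge0.
by move: h1 h3 h4; set I := ip f f; lra.
Qed.

Lemma L2functional_sum F (I : Type) (s : seq I) (c : I -> R) (u : I -> T -> R) :
  L2functional F -> (forall i, u i \in L2) ->
  (fun x => \sum_(i <- s) c i * u i x) \in L2 /\
  F (fun x => \sum_(i <- s) c i * u i x) = \sum_(i <- s) c i * F (u i).
Proof.
move=> [linF _] uL; elim: s => [|i s [IH1 IH2]].
  rewrite big_nil.
  have -> : (fun x => \sum_(i <- [::]) c i * u i x) = (fun=> 0).
    by apply/funext => x; rewrite big_nil.
  split; first exact: L2_0.
  have := linF (-1) (fun=> 0) (fun=> 0) L2_0 L2_0.
  by rewrite [X in F X](_ : _ = fun=> 0); [lra|apply/funext => x;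
    rewrite mulr0 addr0].
rewrite big_cons -IH2 -linF//.
have -> : (fun x => \sum_(j <- i :: s) c j * u j x) =
    (fun x => c i * u i x + \sum_(j <- s) c j * u j x).
  by apply/funext => x; rewrite big_cons.
by split => //; exact: L2_lin.
Qed.

Lemma L2_dominated f g : f \in L2 -> measurable_fun setT g ->
  (forall x, `|g x| <= `|f x|) -> g \in L2.
Proof.
move=> fL mg gf; apply: L2_square_integrable => //.
have := Lfun2_integrable_sqr fL => /integrableP[mf].
apply: le_lt_trans; apply: ge0_le_integral => //.
- by move=> x _; rewrite lee_fin sqr_ge0.
- by apply/measurable_EFinP; exact: measurable_funX.
- exact: measurableT_comp.
- move=> x _ /=; rewrite lee_fin normrX -[leLHS]real_normK ?num_real//.
  by rewrite ler_pXn2r// nnegrE.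
Qed.

(** A bounded functional is continuous, and dominated convergence turns
   pointwise convergence below an L2 function into convergence in L2. *)
Lemma L2functional_dominated F f (g : nat -> T -> R) : L2functional F ->
  f \in L2 ->
  (forall n, measurable_fun setT (g n)) ->
  (forall n x, `|g n x| <= `|f x|) ->
  (forall x, g n x @[n --> \oo] --> f x) ->
  (forall n, F (g n) = 0) -> F f = 0.
Proof.
move=> [linF [C C0 FC]] fL mg gf cg Fg0.
have gL n : g n \in L2 by exact: L2_dominated (gf n).
pose h n x := -1 * g n x + f x.
have hL n : h n \in L2 by exact: L2_lin.
have Fh n : F f = F (h n) by rewrite linF// Fg0 mulr0 add0r.
have H : (\int[mu]_x (h n x ^+ 2)%:E @[n --> \oo] --> \int[mu]_x (cst 0 x))%E.
  apply: (@dominated_cvg _ _ _ _ _ _ _ _ (fun x => 4%:E * (EFin \o (fun x =>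
    (f x ^+ 2)%R)) x)%E) => //.
  - move=> n; apply/measurable_EFinP; apply: measurable_funX;
    exact: L2_measurable.
  - move=> x _; apply/fine_cvgP; split; first exact: nearW.
    have -> : 0 = (-1 * f x + f x) ^+ 2 by rewrite mulN1r addNr expr0n.
    rewrite /comp/= /h expr2; under eq_fun do rewrite expr2.
    by apply: cvgM; apply: cvgD (@cvg_cst _ _ _ _ _); apply: cvgM (cg x);
      exact: cvg_cst.
  (* The factor 4 comes from |f - g n| <= 2 |f|. *)
  - by apply: integrableZl => //; exact: Lfun2_integrable_sqr.
  - move=> n x _; rewrite -EFinM gee0_abs ?lee_fin ?sqr_ge0//.
    rewrite -[leLHS]real_normK ?num_real// -[X in _ * X]real_normK ?num_real//.
    have : `|h n x| <= 2 * `|f x|.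
      rewrite /h mulN1r (le_trans (ler_normD _ _))// normrN.
      by have := gf n x; lra.
    move=> hh; rewrite (_ : 4 * _ = (2 * `|f x|) ^+ 2); last by ring.
    by rewrite ler_pXn2r// ?nnegrE// mulr_ge0.
have {}H : ip (h n) (h n) @[n --> \oo] --> (0:R).
  move: H; rewrite integral0 => /fine_cvgP[_]; apply: cvg_trans.
  by apply: near_eq_cvg; apply: nearW => n /=; rewrite ip_EFin.
have : F f ^+ 2 <= C * 0.
  have K : C * ip (h n) (h n) @[n --> \oo] --> C * 0 by apply: cvgM H;
    exact: cvg_cst.
  rewrite -(cvg_lim (@Rhausdorff R) K); apply: limr_ge.
    by apply/cvg_ex; exists (C * 0).
  by apply: nearW => n; rewrite (Fh n); exact: FC.
by rewrite mulr0 => H0; apply/eqP; rewrite -sqrf_eq0 eq_le H0 sqr_ge0.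
Qed.

Lemma L2_indic (A : set T) : measurable A -> (mu A < +oo)%E -> \1_A \in L2.
Proof.
move=> mA fA; apply: L2_square_integrable => //.
rewrite (eq_integral (fun x => (\1_A x)%:E)); last first.
  by move=> x _; rewrite indicE; case: (_ \in _); rewrite ?expr1n ?expr0n.
by rewrite integral_indic// setIT.
Qed.

End ip.

(** * Functionals vanishing on a generating family of sets *)

Import HBNNSimple.

Section density.
Context d (T : measurableType d) (R : realType) (mu : {measure set T -> \bar R}).
Implicit Types f g h : T -> R.
Local Notation L2 := (Lfun mu 2%:E).
Variables (F : (T -> R) -> R) (G : set (set T)) (E : nat -> set T).
Hypothesis LF : L2functional mu F.
Hypothesis mE : forall n, measurable (E n).
Hypothesis finE : forall n, (mu (E n) < +oo)%E.

Lemma sub_indic_L2 n (X : set T) : measurable X -> \1_(X `&` E n) \in L2.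
Proof.
move=> mX; apply: L2_indic; first exact: measurableI.
by apply: le_lt_trans (finE n); rewrite le_measure ?inE//; exact: measurableI.
Qed.

(** The sets whose indicators are annihilated form a Dynkin class: complements
   by linearity, disjoint unions by domination of the partial sums. *)
Lemma dynkin_functional n : @measurable _ T = <<s G >> -> setI_closed G ->
  F \1_(E n) = 0 -> (forall X, G X -> F \1_(X `&` E n) = 0) ->
  forall X, measurable X -> F \1_(X `&` E n) = 0.
Proof.
move=> GE GI FE FG X; rewrite GE.
have [linF _] := LF.
apply: (@dynkin_induction _ _ G (fun X => F \1_(X `&` E n) = 0)) => //.
- by rewrite setTI.
- move=> A mA FA.
  have -> : \1_(~` A `&` E n) = (fun x => -1 * \1_(A `&` E n) x + \1_(E n) x)
    :> (T -> R).
    apply/funext => x; rewrite !indicE !in_setI in_setC.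
    by case: (x \in A); case: (x \in E n) => /=; ring.
  rewrite linF ?FA ?FE; [by ring|exact: sub_indic_L2|].
  exact: L2_indic.
- move=> Y mY tY FY.
  have mB : measurable (\bigcup_k Y k) by exact: bigcup_measurable.
  have key m x : \sum_(k < m) 1 * \1_(Y k `&` E n) x =
      (`[< exists2 k, (k < m)%N & (Y k `&` E n) x >])%:R :> R.
    have [[k km Yk]|nY] := asboolP.
      rewrite (bigD1 (Ordinal km))//= indicE mem_set// big1 ?mulr1 ?addr0// =>
        i ik.
      rewrite indicE memNset ?mulr0// => -[Yi _].
      have := tY i k I I; case: Yk => Yk _ => H.
      by move: ik; apply/negP; rewrite negbK -val_eqE /= H//; exists x.
    rewrite big1// => i _; rewrite indicE memNset ?mulr0// => Yi.
    by apply: nY; exists (val i) => //; exact: ltn_ord.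
  apply: (L2functional_dominated (g := fun m x =>
    \sum_(k < m) 1 * \1_(Y k `&` E n) x) LF).
  + exact: sub_indic_L2.
  + move=> m; apply: (@L2_measurable _ _ _ mu).
    have [|+ _] := @L2functional_sum _ _ _ mu F _ (index_enum 'I_m) (fun=> 1)
      (fun k => \1_(Y k `&` E n)) LF.
      by move=> i; exact: sub_indic_L2.
    by [].
  + move=> m x; rewrite key; have [[k km [Yk Ex]]|nY] := asboolP;
    last by rewrite normr0.
    by rewrite indicE mem_set//; split => //; exists k.
  + move=> x; apply: cvg_near_cst.
    rewrite indicE; have [xY|xY] := boolP (x \in _).
      move: xY; rewrite inE => -[[k _ Yk] Ex].
      near=> N; rewrite key asboolT//; exists k => //.
      by near: N; exact: nbhs_infty_gt.
    apply: nearW => m; rewrite key asboolF// => -[k _ [Yk Ex]].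
    by move/negP: xY; apply; rewrite inE; split => //; exists k.
  + move=> m.
    have [|_ ->] := @L2functional_sum _ _ _ mu F _ (index_enum 'I_m) (fun=> 1)
      (fun k => \1_(Y k `&` E n)) LF.
      by move=> i; exact: sub_indic_L2.
    by rewrite big1// => i _; rewrite FY mulr0.
Unshelve. all: by end_near.
Qed.

(** The indicators of a generating family stable under intersection span a
   dense subspace: the Dynkin class argument reaches all measurable sets, and
   increasing simple functions reach the rest. The exhaustion E makes all the
   indicators square integrable. *)
Lemma L2functional_eq0 : @measurable _ T = <<s G >> -> setI_closed G ->
  nondecreasing_seq E -> \bigcup_n E n = setT ->
  (forall n, F \1_(E n) = 0) -> (forall X n, G X -> F \1_(X `&` E n) = 0) ->
  forall f, f \in L2 -> F f = 0.
Proof.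
move=> GE GI ndE Ecov FE FG.
have FX X n : measurable X -> F \1_(X `&` E n) = 0.
  by apply: dynkin_functional => // {}X GX; exact: FG.
have [linF _] := LF.
have pos f : f \in L2 -> (forall x, 0 <= f x) -> F f = 0.
  move=> fL f0; have mf := L2_measurable fL.
  have mEf : measurable_fun setT (EFin \o f) by exact/measurable_EFinP.
  pose p := nnsfun_approx measurableT mEf.
  have cpf x : p m x @[m --> \oo] --> f x.
    exact: (fine_cvg (@cvg_nnsfun_approx _ _ _ _ measurableT _ mEf (fun x _ =>
      f0 x) x I)).
  have pf n x : p n x <= f x.
    rewrite -(cvg_lim (@Rhausdorff R) (cpf x));
      apply: (nondecreasing_cvgn_le (u_ := fun m => p m x)).
      by move=> a b ab; exact/lefP/nd_nnsfun_approx.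
    by apply/cvg_ex; exists (f x).
  pose c n (i : nat) : R := nth 0 (finmap.enum_fset (fset_set (range (p n)))) i.
  pose A n (i : nat) := p n @^-1` [set c n i] `&` E n.
  have indE n : (fun x => p n x * \1_(E n) x) = (fun x =>
      \sum_(i < size (finmap.enum_fset (fset_set (range (p n))))) c n i *
        \1_(A n i) x).
    apply/funext => x; rewrite fimfunEord mulr_suml; apply: eq_bigr => i _.
    by rewrite -mulrA indicI.
  apply: (L2functional_dominated (g := fun n x => p n x * \1_(E n) x) LF fL).
  - move=> n; apply: measurable_funM => //.
  - move=> n x; rewrite ger0_norm ?mulr_ge0// ger0_norm//.
    by rewrite (le_trans _ (pf n x))// ler_piMr// indicE; case: (x \in _).
  - move=> x; rewrite -[f x]mulr1; apply: cvgM => //; apply: cvg_near_cst.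
    have : [set: T] x by []. rewrite -Ecov => -[k _ Ekx].
    near=> N; rewrite indicE mem_set//.
    have km : (k <= N)%N by near: N; exact: nbhs_infty_ge.
    by have /subsetPset := ndE _ _ km; exact.
  - move=> n; rewrite indE.
    have [|_ ->] := @L2functional_sum _ _ _ mu F _ (index_enum 'I_(size
      (finmap.enum_fset (fset_set (range (p n))))))
      (fun i => c n i) (fun i => \1_(A n i)) LF.
      by move=> i; exact: sub_indic_L2.
    by rewrite big1// => i _; rewrite FX ?mulr0.
move=> f fL; have mf := L2_measurable fL.
have hL (g : T -> R) : measurable_fun setT g -> (forall x,
  `|g x| <= `|f x|) -> g \in L2.
  by move=> mg gf; exact: L2_dominated gf.
pose f1 x := Num.max (f x) 0; pose f2 x := Num.max (- f x) 0.
have f1L : f1 \in L2.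
  apply: hL; first exact: measurable_maxr.
  by move=> x; rewrite /f1; case: (leP (f x) 0) => // _; rewrite normr0.
have f2L : f2 \in L2.
  apply: hL; first by apply: measurable_maxr => //; exact: measurableT_comp.
  by move=> x; rewrite /f2; case: (leP (- f x) 0) => // _;
    rewrite ?normrN// normr0.
have -> : f = (fun x => -1 * f2 x + f1 x).
  apply/funext => x; rewrite /f1 /f2.
  by case: (leP (f x) 0); case: (leP (- f x) 0); lra.
rewrite linF//.
rewrite (pos f1)// ?(pos f2)//; first by rewrite mulr0 addr0.
  by move=> x; rewrite /f2 le_max lexx orbT.
by move=> x; rewrite /f1 le_max lexx orbT.
Unshelve. all: by end_near.
Qed.

End density.

(** * Pointwise algebra of Haar functions *)

Section haar.
Variable R : realType.
Implicit Types (I J K : dyadic) (x y : R) (k n a : int).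

(** The generation k dyadic interval containing x is (k, cell k x); it turns
   questions about nested or disjoint dyadic intervals into integer
   arithmetic. *)
Definition cell k x : int := Num.floor (x * 2 ^ k).

Lemma dyadic_length_gt0 I : 0 < dyadic_length R I.
Proof. by rewrite /dyadic_length exprz_gt0. Qed.

Lemma mem_dyadic I x : (x \in dyadic_set R I) = (cell I.1 x == I.2).
Proof.
rewrite /cell floor_eq /dyadic_set mem_setE in_itv/= /dyadic_length.
by rewrite -!invr_expz ler_pdivrMr ?ltr_pdivlMr ?exprz_gt0.
Qed.

Lemma dyadic_setP I x : dyadic_set R I x <-> cell I.1 x = I.2.
Proof.
split=> [h|/eqP h]; first by apply/eqP; rewrite -mem_dyadic inE.
by rewrite -mem_dyadic inE in h.
Qed.

Lemma cellS k x : cell k x = (cell (k + 1) x %/ 2)%Z.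
Proof.
rewrite /cell expfzDr ?pnatr_eq0// expr1z mulrA.
set t := x * 2 ^ k; set n := Num.floor (t * 2).
have /andP[h1 h2] : n%:~R <= t * 2 < (n + 1)%:~R by exact: floor_itv.
apply: floor_def; set q := (n %/ 2)%Z.
have q1 : (2 * q <= n)%R by rewrite /q; lia.
have q2 : (n + 1 <= 2 * (q + 1))%R by rewrite /q; lia.
move: q1 q2; rewrite -(ler_int R) -[in X in _ -> X ->
  _](ler_int R) !intrM !intrD => q1 q2.
apply/andP; split; first by lra.
by move: h2 q2; rewrite !intrD; lra.
Qed.

Lemma cell_mono k n x y : k <= n -> cell n x = cell n y -> cell k x = cell k y.
Proof.
move=> kn; have -> : n = k + `|n - k|%N by lia.
elim: `|n - k|%N => [|m IH]; first by rewrite addr0.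
rewrite -addn1 PoszD addrA => e; apply: IH.
by rewrite (cellS (k + m)) e -cellS.
Qed.

Lemma indic_dyadic I x : \1_(dyadic_set R I) x = (cell I.1 x == I.2)%:R :> R.
Proof. by rewrite indicE mem_dyadic. Qed.

Lemma dyadic_inhab I : exists x : R, cell I.1 x = I.2.
Proof.
exists (I.2%:~R * 2 ^ (- I.1)); apply/dyadic_setP.
rewrite /dyadic_set /= in_itv/= lexx/= ltr_pM2r ?dyadic_length_gt0// ltr_int;
  lia.
Qed.

Lemma haarE I x : haar I x = (Num.sqrt (dyadic_length R I))^-1 *
  ((cell (I.1 + 1) x == 2 * I.2 + 1)%:R - (cell (I.1 + 1) x == 2 * I.2)%:R).
Proof. by rewrite /haar !indic_dyadic. Qed.

Lemma haar_supp I x : cell I.1 x != I.2 -> haar I x = 0.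
Proof.
rewrite (cellS I.1) haarE => h.
have -> : (cell (I.1 + 1) x == 2 * I.2 + 1) = false by apply/negP; lia.
have -> : (cell (I.1 + 1) x == 2 * I.2) = false by apply/negP; lia.
by rewrite subrr mulr0.
Qed.

(** A coarser Haar function only sees the ancestors of I. *)
Lemma haar_const I K x y : K.1 < I.1 -> cell I.1 x = cell I.1 y ->
  haar K x = haar K y.
Proof.
by move=> KI e; rewrite !haarE (@cell_mono (K.1 + 1) _ x y _ e)//; lia.
Qed.

Lemma haar_sq I x :
  haar I x * haar I x = (dyadic_length R I)^-1 * \1_(dyadic_set R I) x.
Proof.
rewrite haarE indic_dyadic mulrACA -invfM -expr2 sqr_sqrtr ?(ltW
  (dyadic_length_gt0 I))//.
congr (_ * _); rewrite (cellS I.1).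
have [e1|h1] := eqVneq (cell (I.1 + 1) x) (2 * I.2).
  rewrite e1.
  have -> : (2 * I.2 == 2 * I.2 + 1) = false by lia.
  have -> : ((2 * I.2 %/ 2)%Z == I.2) by lia.
  by rewrite sub0r mulrNN mulr1.
have [e2|h2] := eqVneq (cell (I.1 + 1) x) (2 * I.2 + 1).
  rewrite e2.
  have -> : (((2 * I.2 + 1) %/ 2)%Z == I.2) by lia.
  by rewrite subr0 mulr1.
have -> : ((cell (I.1 + 1) x %/ 2)%Z == I.2) = false by apply/negP; lia.
by rewrite subrr mulr0.
Qed.

(** On the finer interval the coarser Haar function is constant; at equal
   generations the supports are disjoint and the constant is zero. *)
Lemma haar_mul K I : K != I -> K.1 <= I.1 ->
  exists c, forall x, haar K x * haar I x = c * haar I x.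
Proof.
move=> KI; rewrite le_eqVlt => /predU1P[e|lt].
  exists 0 => x; rewrite mul0r.
  have [eI|nI] := eqVneq (cell I.1 x) I.2; last by rewrite (haar_supp nI) mulr0.
  rewrite haar_supp ?mul0r// e eI; apply: contra KI => /eqP e2.
  by rewrite [K]surjective_pairing [I]surjective_pairing e e2.
have [y yI] := dyadic_inhab I; exists (haar K y) => x.
have [eI|nI] := eqVneq (cell I.1 x) I.2; last by rewrite (haar_supp nI) !mulr0.
by rewrite (@haar_const I K x y)// eI yI.
Qed.

Definition odd_dyadic I := ~~ ((I.1 %% 2)%Z == 0).

Lemma even_dyadicP I : even_dyadic R I <-> ~~ odd_dyadic I.
Proof.
rewrite negbK; split.
  move=> [k]; rewrite /dyadic_length => /ieexprIz.
  rewrite pnatr_eq1 ltr0n => /(_ isT isT); lia.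
by move=> /eqP h; exists (I.1 %/ 2)%Z; congr (2 ^ _); lia.
Qed.

(** The image of h_K under the dyadic shift, as a function defined
   everywhere. *)
Definition haar_shift K x : R :=
  if odd_dyadic K then 0 else haar (right_half K) x - haar (left_half K) x.

(** Finite linear combinations of Haar functions of intervals satisfying P. The
   inductive form gives linearity arguments by plain induction. *)
Inductive haar_comb (P : dyadic -> Prop) : (R -> R) -> Prop :=
| haar_comb0 : haar_comb P (fun=> 0)
| haar_combS c K u : P K -> haar_comb P u ->
    haar_comb P (fun x => c * haar K x + u x).

Lemma eq_haar_comb P u v : haar_comb P u -> (forall x,
  u x = v x) -> haar_comb P v.
Proof. by move=> hu e; have <- : u = v by apply/funext. Qed.

Lemma haar_comb_lin P c u v : haar_comb P u -> haar_comb P v ->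
  haar_comb P (fun x => c * u x + v x).
Proof.
move=> hu hv; elim: hu => [|b K w PK hw IH].
  by apply: eq_haar_comb hv _ => x; rewrite mulr0 add0r.
by apply: eq_haar_comb (haar_combS (c * b) PK IH) _ => x; ring.
Qed.

Lemma haar_combZ P c u : haar_comb P u -> haar_comb P (fun x => c * u x).
Proof.
move=> hu; apply: eq_haar_comb (haar_comb_lin c hu (haar_comb0 P)) _ => x.
by rewrite addr0.
Qed.

Lemma haar_comb1 (P : dyadic -> Prop) K : P K -> haar_comb P (haar K).
Proof.
move=> PK; apply: eq_haar_comb (haar_combS 1 PK (haar_comb0 P)) _ => x.
by rewrite mul1r addr0.
Qed.

Lemma haar_comb_weaken (P Q : dyadic -> Prop) u : (forall I,
  P I -> Q I) -> haar_comb P u -> haar_comb Q u.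
Proof.
move=> PQ; elim=> [|c K v PK hv IH]; first exact: haar_comb0.
by apply: haar_combS => //; exact: PQ.
Qed.

Lemma haar_mul_comb (P : dyadic -> Prop) K I : K != I -> P K -> P I ->
  haar_comb P (fun x => haar K x * haar I x).
Proof.
move=> KI PK PI; have [le|/ltW le] := leP K.1 I.1.
  have [c e] := haar_mul KI le.
  by apply: eq_haar_comb (haar_combZ c (haar_comb1 PI)) _ => x; rewrite e.
rewrite eq_sym in KI; have [c e] := haar_mul KI le.
by apply: eq_haar_comb (haar_combZ c (haar_comb1 PK)) _ => x; rewrite -e mulrC.
Qed.

Lemma odd_half K : ~~ odd_dyadic K -> odd_dyadic (left_half K) /\
  odd_dyadic (right_half K).
Proof. by rewrite /odd_dyadic /= => h; split; lia. Qed.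

Lemma haar_shift_comb K : haar_comb odd_dyadic (haar_shift K).
Proof.
case: (boolP (odd_dyadic K)) => oK; last first.
  have [h1 h2] := odd_half oK.
  apply: eq_haar_comb (haar_comb_lin (-1) (haar_comb1 h1) (haar_comb1 h2)) _
    => x.
  by rewrite /haar_shift (negbTE oK); ring.
by apply: eq_haar_comb (haar_comb0 _) _ => x; rewrite /haar_shift oK.
Qed.

(** For even K <> I the halves involved are four odd intervals, and no half of
   K is a half of I; so each of the four products is a multiple of an odd Haar
   function. *)
Lemma haar_shift_mul_comb K I : K != I ->
  haar_comb odd_dyadic (fun x => haar_shift K x * haar_shift I x).
Proof.
move=> KI; case: (boolP (odd_dyadic K)) => oK.
  by apply: eq_haar_comb (haar_comb0 _) _ => x; rewrite /haar_shift oK mul0r.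
case: (boolP (odd_dyadic I)) => oI.
  by apply: eq_haar_comb (haar_comb0 _) _ => x; rewrite /haar_shift oI mulr0.
have [Kl Kr] := odd_half oK; have [Il Ir] := odd_half oI.
have neq (f g : dyadic -> dyadic) : (f = left_half \/ f = right_half) ->
    (g = left_half \/ g = right_half) -> f K != g I.
  move=> hf hg; apply: contra KI; case: K I {oK oI Kl Kr Il Ir} => [k m] [n a].
  by case: hf => ->; case: hg => ->; rewrite /left_half /right_half
    !xpair_eqE/=; lia.
pose M := @haar_mul_comb (fun J => odd_dyadic J).
have H := haar_comb_lin (-1) (M _ _ (neq left_half right_half (or_introl
  erefl) (or_intror erefl)) Kl Ir)
  (M _ _ (neq right_half right_half (or_intror erefl) (or_intror erefl)) Kr Ir).
have H' := haar_comb_lin (-1) (M _ _ (neq right_half left_half (or_intror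
  erefl) (or_introl erefl)) Kr Il)
  (M _ _ (neq left_half left_half (or_introl erefl) (or_introl erefl)) Kl Il).
apply: eq_haar_comb (haar_comb_lin 1 H H') _ => x.
by rewrite /haar_shift (negbTE oK) (negbTE oI); ring.
Qed.

(** Both squares are multiples of the indicator of I: h_I^2 has height 1/|I|,
   while the two halves of the shifted function have height 2/|I|. This
   cancellation removes the diagonal terms, whose Haar expansion would be
   infinite. *)
Lemma haar_shift_sq I x : ~~ odd_dyadic I ->
  2 * (haar I x * haar I x) - haar_shift I x * haar_shift I x = 0.
Proof.
move=> oI; rewrite /haar_shift (negbTE oI).
have e : haar (left_half I) x * haar (right_half I) x = 0.
  have [h|h] := eqVneq (cell (I.1 + 1) x) (2 * I.2);
    last by rewrite haar_supp ?mul0r.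
  by rewrite mulrC haar_supp ?mul0r//= h; lia.
have -> : 2 * (haar I x * haar I x) - (haar (right_half I) x - haar (left_half
  I) x) *
   (haar (right_half I) x - haar (left_half I) x) =
   2 * (haar I x * haar I x) - haar (right_half I) x * haar (right_half I) x
    - haar (left_half I) x * haar (left_half I) x
    + 2 * (haar (left_half I) x * haar (right_half I) x) by ring.
rewrite e !haar_sq !indic_dyadic/= (cellS I.1).
have l a : dyadic_length R (I.1 + 1, a) = dyadic_length R I / 2.
  by rewrite /dyadic_length/= opprD expfzDr ?pnatr_eq0// exprN1.
rewrite !l invf_div.
have := dyadic_length_gt0 I; set L := dyadic_length R I => L0.
have -> : ((cell (I.1 + 1) x %/ 2)%Z == I.2)%:R =
   (cell (I.1 + 1) x == 2 * I.2 + 1)%:R + (cell (I.1 + 1) x == 2 * I.2)%:R :> R.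
  have [e1|h1] := eqVneq (cell (I.1 + 1) x) (2 * I.2).
    rewrite e1.
    have -> : (2 * I.2 == 2 * I.2 + 1) = false by lia.
    have -> : ((2 * I.2 %/ 2)%Z == I.2) by lia.
    by rewrite add0r.
  have [e2|h2] := eqVneq (cell (I.1 + 1) x) (2 * I.2 + 1).
    rewrite e2.
    have -> : (((2 * I.2 + 1) %/ 2)%Z == I.2) by lia.
    by rewrite addr0.
  have -> : ((cell (I.1 + 1) x %/ 2)%Z == I.2) = false by apply/negP; lia.
  by rewrite addr0.
by field; rewrite gt_eqF.
Qed.

(** The indicators of the two halves have the parent's indicator as their sum
   and a multiple of its Haar function as their difference. *)
Lemma indic_dyadic_parent n a : exists c, forall x,
  \1_(dyadic_set R (n, a)) x = c * haar (n - 1, (a %/ 2)%Z) x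
     + 2^-1 * \1_(dyadic_set R (n - 1, (a %/ 2)%Z)) x :> R.
Proof.
pose I : dyadic := (n - 1, (a %/ 2)%Z).
pose s := Num.sqrt (dyadic_length R I).
have s0 : s != 0 by rewrite sqrtr_eq0 -ltNge dyadic_length_gt0.
(* The sign tells whether the interval is the left or the right half. *)
exists ((if (a %% 2)%Z == 0 then -1 else 1) * 2^-1 * s) => x.
rewrite haarE !indic_dyadic/= (cellS (n - 1)) subrK -/s.
have st t : s * (s^-1 * t) = t by rewrite mulrA divff ?mul1r.
rewrite -(mulrA _ s) st.
case: ifPn => ha; case: (eqVneq (cell n x) a) => [->|h1].
- have -> : (a == 2 * (a %/ 2)%Z + 1) = false by lia.
  have -> : (a == 2 * (a %/ 2)%Z) by lia.
  by rewrite !eqxx /=; field.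
- have -> : (cell n x == 2 * (a %/ 2)%Z) = false by apply/negP; lia.
  have -> : ((cell n x %/ 2)%Z == (a %/ 2)%Z) =
    (cell n x == 2 * (a %/ 2)%Z + 1) by lia.
  by case: (_ == _) => /=; field.
- have -> : (a == 2 * (a %/ 2)%Z + 1) by lia.
  have -> : (a == 2 * (a %/ 2)%Z) = false by lia.
  by rewrite !eqxx /=; field.
have -> : (cell n x == 2 * (a %/ 2)%Z + 1) = false by apply/negP; lia.
have -> : ((cell n x %/ 2)%Z == (a %/ 2)%Z) =
  (cell n x == 2 * (a %/ 2)%Z) by lia.
by case: (_ == _) => /=; field.
Qed.

End haar.

(** * Haar functions in L2 of the line *)

Section line.
Variable R : realType.
Implicit Types (I J K : dyadic) (x y : R) (k n a : int).
Local Notation mu := (@lebesgue_measure R).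
Local Notation L2 := (Lfun mu 2%:E).

Lemma measurable_dyadic I : measurable (dyadic_set R I : set (measurableTypeR
  R)).
Proof. exact: measurable_itv. Qed.

Lemma mu_dyadic I : mu (dyadic_set R I) = (dyadic_length R I)%:E.
Proof.
rewrite /dyadic_set lebesgue_measure_itv/= lte_fin ltr_pM2r
  ?dyadic_length_gt0// ltr_int.
by rewrite ltzD1 lexx -EFinB -mulrBl intrD addrAC subrr add0r mul1r.
Qed.

Lemma indic_L2 I : \1_(dyadic_set R I) \in L2.
Proof.
have h : (mu (dyadic_set R I) < +oo)%E by rewrite mu_dyadic ltry.
exact: (L2_indic (measurable_dyadic I) h).
Qed.

Lemma ip_indic (A B : set (measurableTypeR R)) : measurable A -> measurable B ->
  ip mu \1_A \1_B = fine (mu (A `&` B)).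
Proof.
move=> mA mB; rewrite -(setIT (A `&` B)) -integral_indic//;
  last exact: measurableI.
by congr fine; apply: eq_integral => x _; rewrite indicI.
Qed.

Lemma ip_indic_sub I K : dyadic_set R I `<=` dyadic_set R K ->
  ip mu \1_(dyadic_set R I) \1_(dyadic_set R K) = dyadic_length R I.
Proof.
move=> IK; rewrite ip_indic; [|exact: measurable_dyadic..].
by rewrite (setIidl IK) mu_dyadic.
Qed.

Lemma haar_L2 I : haar I \in L2.
Proof.
pose s := (Num.sqrt (dyadic_length R I))^-1.
have h := L2_lin s (indic_L2 (right_half I)) (L2_Z (- s) (indic_L2 (left_half
  I))).
suff -> : haar I = (fun x => s * \1_(dyadic_set R (right_half I)) x +
    (- s) * \1_(dyadic_set R (left_half I)) x) by [].
by apply/funext => x; rewrite /haar -/s; ring.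
Qed.

Lemma haar_comb_L2 P u : haar_comb P u -> u \in L2.
Proof.
elim=> [|c K v _ _ vL]; first exact: L2_0.
by apply: L2_lin => //; exact: haar_L2.
Qed.

Lemma ip_haar_indic I : ip mu (haar I) \1_(dyadic_set R I) = 0.
Proof.
pose s := (Num.sqrt (dyadic_length R I))^-1.
rewrite (_ : haar I = (fun x => s * \1_(dyadic_set R (right_half I)) x +
    (- s) * \1_(dyadic_set R (left_half I)) x)); last first.
  by apply/funext => x; rewrite /haar -/s; ring.
have sub (J : dyadic) : (J.1 = I.1 + 1) -> (J.2 %/ 2)%Z =
  I.2 -> dyadic_set R J `<=` dyadic_set R I.
  move=> e1 e2 x /dyadic_setP h; apply/dyadic_setP.
  by rewrite cellS -e1 h.
rewrite ip_linear ?ip_Z ?indic_L2 ?L2_Z ?indic_L2// !ip_indic_sub; last 2 first.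
- by apply: sub => //=; lia.
- by apply: sub => //=; lia.
by rewrite /dyadic_length/=; ring.
Qed.

Lemma ip_haar K I : ip mu (haar K) (haar I) = (K == I)%:R.
Proof.
wlog le : K I / K.1 <= I.1.
  move=> W; have [le|/ltW le] := leP K.1 I.1; first exact: W.
  by rewrite ipC eq_sym W.
have [->|KI] := eqVneq K I.
  transitivity (ip mu (fun x => (dyadic_length R I)^-1 * \1_(dyadic_set R I)
    x) \1_(dyadic_set R I)).
    apply: eq_Rintegral => x _; rewrite haar_sq -mulrA indic_dyadic;
      congr (_ * _).
    by case: (_ == _); rewrite /= ?mulr1 ?mulr0.
  by rewrite ip_Z ?indic_L2// ip_indic_sub// mulVf// gt_eqF ?dyadic_length_gt0.
have [c e] := haar_mul R KI le.
transitivity (ip mu (fun x => c * haar I x) \1_(dyadic_set R I)).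
  apply: eq_Rintegral => x _; rewrite e -mulrA; congr (_ * _).
  rewrite indic_dyadic; have [h|h] := eqVneq (cell I.1 x) I.2.
    by rewrite /= mulr1.
  by rewrite haar_supp// mul0r.
by rewrite ip_Z ?haar_L2 ?indic_L2// ip_haar_indic mulr0.
Qed.

Lemma haar_shift_L2 I : haar_shift I \in L2.
Proof. exact: haar_comb_L2 (haar_shift_comb R I). Qed.

(** Distinct even intervals have no common half, so the shift is sqrt 2 times
   an isometry on even Haar functions. *)
Lemma ip_haar_shift K I : ~~ odd_dyadic I ->
  ip mu (haar_shift K) (haar_shift I) = 2 * (K == I)%:R.
Proof.
move=> oI.
case: (boolP (odd_dyadic K)) => oK.
  have -> : K == I = false by apply/negP => /eqP e; move: oI; rewrite -e oK.
  rewrite mulr0 -(ip0 mu (haar_shift I)); congr ip; apply/funext => x.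
  by rewrite /haar_shift oK.
have e J : ~~ odd_dyadic J ->
    @haar_shift R J = (fun x => -1 * haar (left_half J) x + haar (right_half
      J) x).
  by move=> oJ; apply/funext => x; rewrite /haar_shift (negbTE oJ); ring.
rewrite !e// ip_linear ?haar_L2 ?L2_lin ?haar_L2//.
rewrite ![ip mu _ (fun x => _ + _)]ipC !ip_linear ?haar_L2// !ip_haar.
have -> : (left_half I == left_half K) = (K == I).
  by case: K I {oI oK} => [k m] [n a]; rewrite /left_half !xpair_eqE/=; lia.
have -> : (right_half I == right_half K) = (K == I).
  by case: K I {oI oK} => [k m] [n a]; rewrite /right_half !xpair_eqE/=; lia.
have -> : (right_half I == left_half K) = false.
  by case: K I {oI oK} => [k m] [n a]; rewrite /right_half/left_half
    !xpair_eqE/=; lia.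
have -> : (left_half I == right_half K) = false.
  by case: K I {oI oK} => [k m] [n a]; rewrite /right_half/left_half
    !xpair_eqE/=; lia.
by rewrite /=; ring.
Qed.

(** Two intervals of one generation have a common dyadic ancestor exactly when
   they lie on the same side of the origin. *)
Definition same_side (a a' : int) := (0 <= a) = (0 <= a').

(** Passing to the parent halves an indicator modulo Haar functions, and after
   finitely many generations both intervals have the same ancestor. *)
Lemma indic_diff_comb n a a' : same_side a a' ->
  haar_comb xpredT
    (fun x => \1_(dyadic_set R (n, a)) x - \1_(dyadic_set R (n, a')) x).
Proof.
(* Every interval is compared with the one of its generation touching the
   origin (first index 0, or -1 on the negative side), which is fixed by
   passing to the parent. *)
pose base (c : int) : int := if 0 <= c then 0 else -1.
suff H c : haar_comb xpredT (fun x => \1_(dyadic_set R (n,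
  c)) x - \1_(dyadic_set R (n, base c)) x).
  move=> aa'; apply: eq_haar_comb (haar_comb_lin (-1) (H a') (H a)) _ => x.
  by rewrite /base -aa'; ring.
have [m] := ubnP `|c|%N; elim: m c n => // m IH c n cm.
have [->|c0] := eqVneq c (base c).
  apply: eq_haar_comb (haar_comb0 _ _) _ => x.
  by rewrite (_ : base (base c) = base c) ?subrr// /base; case: (leP 0 c).
have [d e] := indic_dyadic_parent R n c.
have [d' e'] := indic_dyadic_parent R n (base c).
have bb : (base c %/ 2)%Z = base c by rewrite /base; case: ifP.
have cb : base (c %/ 2)%Z = base c.
  by rewrite /base; do 2 case: ifP; lia.
have {}IH := IH (c %/ 2)%Z (n - 1) _.
have {}IH : haar_comb xpredT (fun x => \1_(dyadic_set R (n - 1, (c %/ 2)%Z)) x -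
    \1_(dyadic_set R (n - 1, base c)) x).
  rewrite -cb; apply: IH.
  by move: c0 cm; rewrite /base; case: ifP; lia.
apply: eq_haar_comb (haar_combS d (K := (n - 1,
  (c %/ 2)%Z)) isT (haar_combS (- d') (K := (n - 1,
  base c)) isT (haar_combZ 2^-1 IH))) _ => x.
by rewrite e e' bb; ring.
Qed.

End line.

(** * Completeness of the Haar system and the adjoint of the shift *)

Section completeness.
Variable R : realType.
Implicit Types (I J K : dyadic) (x y : R).
Local Notation mu := (@lebesgue_measure R).
Local Notation L2 := (Lfun mu 2%:E).

Definition dyadic_family : set (set (measurableTypeR R)) :=
  [set X | X = set0 \/ exists I, X = dyadic_set R I].

Lemma dyadic_setI I J : I.1 <= J.1 ->
  dyadic_set R I `&` dyadic_set R J = set0 \/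
  dyadic_set R I `&` dyadic_set R J = dyadic_set R J.
Proof.
move=> IJ; have [y yJ] := dyadic_inhab R J.
have [h|h] := eqVneq (cell I.1 y) I.2; [right|left].
  apply/setIidr => x /dyadic_setP xJ; apply/dyadic_setP.
  by rewrite -h; apply: cell_mono IJ _; rewrite xJ yJ.
rewrite -subset0 => x [/dyadic_setP xI /dyadic_setP xJ].
move/eqP: h; apply; rewrite -xI; apply: cell_mono IJ _; by rewrite xJ yJ.
Qed.

Lemma setI_closed_dyadic : setI_closed dyadic_family.
Proof.
move=> _ _ [->|[I ->]] [->|[J ->]]; rewrite ?set0I ?setI0; do ?by left.
have [le|/ltW le] := leP I.1 J.1.
  by have [->|->] := dyadic_setI le; [left|right; exists J].
by rewrite setIC; have [->|->] := dyadic_setI le; [left|right; exists I].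
Qed.

(** A closed half-line is an intersection over k of countable unions of
   generation k intervals. *)
Lemma sigma_dyadic : @measurable _ (measurableTypeR R) = <<s dyadic_family >>.
Proof.
rewrite eqEsubset; split=> X; last first.
  apply: smallest_sub; first exact: sigma_algebra_measurable.
  by move=> _ [->|[I ->]]; [exact: measurable0|exact: measurable_dyadic].
move=> mX; have {mX} : (@RGenCInfty.G R).-sigma.-measurable X.
  by rewrite -RGenCInfty.measurableE.
apply: smallest_sub; first exact: smallest_sigma_algebra.
move=> _ [x ->].
rewrite (_ : `[x, +oo[%classic = \bigcap_(k : nat)
   (\bigcup_(m : nat) dyadic_set R (k%:Z, cell k%:Z x + m%:Z))).
  apply: (@bigcapT_measurable _ (g_sigma_algebraType dyadic_family)) => k.
  apply: bigcupT_measurable => m; apply: sub_sigma_algebra; right.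
  by eexists.
apply/seteqP; split => y /=.
  rewrite in_itv/= andbT => xy k _; exists `|cell k y - cell k x|%N => //.
  apply/dyadic_setP => /=; suff : cell k x <= cell k y by lia.
  by rewrite le_floor// ler_wpM2r// exprz_ge0.
move=> H; rewrite in_itv/= andbT leNgt; apply/negP => yx.
pose e := x - y.
have e0 : 0 < e by rewrite subr_gt0.
pose k : nat := (Num.truncn e^-1).+1.
have [m _ /dyadic_setP/= h] := H k I.
have h1 : y * 2 ^ k%:Z >= (cell k x)%:~R.
  by rewrite -floor_ge_int -/(cell k y) h; lia.
have h2 : x * 2 ^ k%:Z < (cell k x + 1)%:~R by exact: floorD1_gt.
have h3 : e * 2 ^ k%:Z < 1 by rewrite mulrBl; move: h2; rewrite intrD; lra.
have h4 : e^-1 < k%:R by rewrite /k Num.Theory.truncnS_gt.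
have h5 : k%:R <= 2 ^+ k :> R by rewrite -natrX ler_nat ltnW// ltn_expl.
have : e * e^-1 < 1.
  apply: le_lt_trans h3; rewrite ler_pM2l// (le_trans (ltW h4))//.
by rewrite divff ?gt_eqF// ltxx.
Qed.

(** The two intervals of length 2^n touching the origin: nested dyadic
   intervals stay on one side of it, so both are needed to exhaust the line. *)
Definition box (n : nat) : set (measurableTypeR R) :=
  dyadic_set R (- n%:Z, 0) `|` dyadic_set R (- n%:Z, -1).

Lemma boxP n x : box n x <-> cell (- n%:Z) x = 0 \/ cell (- n%:Z) x = -1.
Proof.
split=> [[/dyadic_setP h|/dyadic_setP h]|[h|h]]; [by left|by right|left|right];
  exact/dyadic_setP.
Qed.

Lemma measurable_box n : measurable (box n).
Proof. by apply: measurableU; exact: measurable_dyadic. Qed.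

Lemma box_finite n : (mu (box n) < +oo)%E.
Proof.
have h : (mu (box n) <= mu (dyadic_set R (- n%:Z,
  0)%R) + mu (dyadic_set R (- n%:Z, -1)%R))%E.
  by apply: measureU2; exact: measurable_dyadic.
by apply: (le_lt_trans h); rewrite !mu_dyadic -EFinD ltry.
Qed.

Lemma box_nd : nondecreasing_seq box.
Proof.
apply/nondecreasing_seqP => n; apply/subsetPset => x /boxP h; apply/boxP.
rewrite cellS (_ : - n.+1%:Z + 1 = - n%:Z); last by lia.
by case: h => ->; [left|right].
Qed.

Lemma box_cover : \bigcup_n box n = setT.
Proof.
apply/seteqP; split => // x _; exists (Num.truncn `|x|).+1 => //; apply/boxP.
set n := _.+1.
have h : `|x| < 2 ^+ n.
  apply: lt_trans (Num.Theory.truncnS_gt _) _.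
  by rewrite -natrX ltr_nat ltn_expl.
have {}h : `|x * 2 ^ (- n%:Z)| < 1.
  rewrite normrM (ger0_norm (exprz_ge0 _ _))//.
  by rewrite -invr_expz ltr_pdivrMr ?exprz_gt0// mul1r.
rewrite /cell; move: h; rewrite ltr_norml => /andP[h1 h2].
case: (leP 0 (x * 2 ^ (- n%:Z))) => h3; [left|right]; apply: floor_def.
  by rewrite h3.
by rewrite h3 (ltW h1).
Qed.

(** The Haar system spans a dense subspace. On indicators, passing to the
   parent halves the value of F and doubles the length; so after j steps the
   bound on the square of the value has improved by 2^j, and F vanishes on all
   dyadic indicators. *)
Lemma haar_complete (F : (R -> R) -> R) : L2functional mu F ->
  (forall K, F (haar K) = 0) -> forall u, u \in L2 -> F u = 0.
Proof.
move=> LF FH; have [linF [C C0 FC]] := LF.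
have F0 : F (fun=> 0) = 0.
  have := linF (-1) _ _ (haar_L2 R (0,0)) (haar_L2 R (0,0)).
  rewrite FH mulr0 addr0 => h; rewrite -[RHS]h; congr F; apply/funext => x;
    ring.
have FI j (n a : int) : F \1_(dyadic_set R (n,
  a)) ^+ 2 * 2 ^+ j <= C * 2 ^ (- n).
  elim: j n a => [|j IH] n a.
    rewrite expr0 mulr1; apply: (le_trans (FC _ (indic_L2 R _))).
    by rewrite ip_indic_sub.
  have [c e] := indic_dyadic_parent R n a.
  have -> : F \1_(dyadic_set R (n, a)) = 2^-1 * F \1_(dyadic_set R (n - 1,
    (a %/ 2)%Z)).
    transitivity (F (fun x => c * haar (n - 1, (a %/ 2)%Z) x
       + (2^-1 * \1_(dyadic_set R (n - 1, (a %/ 2)%Z)) x + 0))).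
      by congr F; apply/funext => x; rewrite e addr0.
    rewrite !linF ?FH ?F0 ?addr0 ?mulr0 ?add0r//.
    - exact: indic_L2.
    - exact: L2_0.
    - exact: haar_L2.
    - apply: L2_lin; [exact: indic_L2|exact: L2_0].
  have := IH (n - 1) (a %/ 2)%Z; rewrite opprB addrC expfzDr ?pnatr_eq0//
    expr1z [2 ^+ j.+1]exprS.
  set f := F _; set t := 2 ^+ j; set s := 2 ^ (- n); lra.
have FD J : F \1_(dyadic_set R J) = 0.
  case: J => n a; apply/eqP; rewrite -sqrf_eq0 eq_le sqr_ge0 andbT leNgt;
    apply/negP => f0.
  set f := F _ ^+ 2 in f0; set B := C * 2 ^ (- n).
  pose j := (Num.truncn (B / f)).+1.
  have := FI j n a; rewrite -/f -/B leNgt => /negP; apply.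
  rewrite mulrC -ltr_pdivrMr//; apply: lt_trans (Num.Theory.truncnS_gt _) _.
  by rewrite -natrX ltr_nat ltn_expl.
have Fset0 : F \1_set0 = 0 by rewrite indic0 F0.
have split X n : measurable (X : set (measurableTypeR R)) ->
  F \1_(X `&` box n) =
    F \1_(X `&` dyadic_set R (- n%:Z, 0)) + F \1_(X `&` dyadic_set R (- n%:Z,
      -1)).
  move=> mX; have XL I : \1_(X `&` dyadic_set R I) \in L2.
    apply: L2_indic; first by apply: measurableI => //;
      exact: measurable_dyadic.
    apply: (@le_lt_trans _ _ (mu (dyadic_set R I)));
      last by rewrite mu_dyadic ltry.
    apply: le_measure; rewrite ?inE; [apply: measurableI => //|..];
      try exact: measurable_dyadic.
    exact: subIsetr.
  rewrite -[X in _ = X + _]mul1r -linF//; congr F; apply/funext => x.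
  rewrite !indicE !in_setI in_setU !mem_dyadic/=.
  case: (x \in X) => /=; last by rewrite mulr0 add0r.
  have [->|] := eqVneq (cell (- n%:Z) x) 0; first by rewrite mul1r addr0.
  by rewrite /= mulr0 add0r.
have FX X J : dyadic_family X -> F \1_(X `&` dyadic_set R J) = 0.
  move=> [->|[I ->]]; first by rewrite set0I.
  have : dyadic_family (dyadic_set R I `&` dyadic_set R J).
    by apply: setI_closed_dyadic; right; [exists I|exists J].
  by move=> [->|[I' ->]].
apply: (@L2functional_eq0 _ _ _ mu F dyadic_family box) => //.
- exact: measurable_box.
- exact: box_finite.
- exact: sigma_dyadic.
- exact: setI_closed_dyadic.
- exact: box_nd.
- exact: box_cover.
- by move=> n; rewrite -[box n]setTI split// !setTI !FD addr0.
- move=> X n GX; rewrite split ?FX ?addr0//.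
  by rewrite sigma_dyadic; exact: sub_gen_smallest.
Qed.

Lemma dyadic_shift_haar S K : dyadic_shift S ->
  {ae mu, forall x, S (haar K) x = haar_shift K x}.
Proof.
move=> [_ Se So]; case: (boolP (odd_dyadic K)) => oK.
  have nK : ~ even_dyadic R K by move/even_dyadicP; rewrite oK.
  by move: (So K nK); apply: ae_imp => x ->; rewrite /haar_shift oK.
move: (Se K (proj2 (even_dyadicP R K) oK)); apply: ae_imp => x ->.
by rewrite /haar_shift (negbTE oK).
Qed.

(** The adjoint of the shift maps the shifted h_I to 2 h_I. By completeness
   it is enough to compare the two sides on Haar functions, where both are 2
   or 0. *)
Lemma shift_adjoint S I u : dyadic_shift S -> ~~ odd_dyadic I -> u \in L2 ->
  ip mu (S u) (haar_shift I) = 2 * ip mu u (haar I).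
Proof.
move=> dS oI uL; have [bS _ _] := dS; have [SL _ _] := bS.
apply/eqP; rewrite -subr_eq0; apply/eqP.
apply: (haar_complete (L2functional_sub 2 (L2functional_op bS (haar_shift_L2 R
  I)) (L2functional_ip (haar_L2 R I)))) uL => K.
rewrite (@ip_aeq _ _ _ mu _ (haar_shift K)) ?ip_haar_shift ?ip_haar ?subrr//.
- exact: SL (haar_L2 R K).
- exact: haar_shift_L2.
- exact: haar_shift_L2.
- exact: dyadic_shift_haar.
Qed.

End completeness.

(** * Elementary tensors in L2 of the plane *)

Section plane.
Variable R : realType.
Implicit Types (I J K : dyadic) (x y : R) (u v : R -> R).
Local Notation mu := (@lebesgue_measure R).
Local Notation pi := (plane_measure R).
Local Notation L2 := (Lfun mu 2%:E).
Local Notation L2p := (Lfun pi 2%:E).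

Lemma measurable_tensor u v :
  measurable_fun [set: measurableTypeR R] u ->
    measurable_fun [set: measurableTypeR R] v ->
  measurable_fun [set: measurableTypeR R * measurableTypeR R] (tensor u v).
Proof.
move=> mu_ mv; apply: measurable_funM.
  exact: (measurableT_comp mu_ measurable_fst).
exact: (measurableT_comp mv measurable_snd).
Qed.

Lemma tensor_integral u v : mu.-integrable setT (EFin \o u) ->
  mu.-integrable setT (EFin \o v) ->
  pi.-integrable setT (EFin \o tensor u v) /\
  \int[pi]_z tensor u v z = (\int[mu]_x u x) * (\int[mu]_y v y).
Proof.
move=> iu iv; have [mu_ fu] := integrableP _ _ _ iu;
  have [mv fv] := integrableP _ _ _ iv.
have mt : measurable_fun [set: measurableTypeR R * measurableTypeR R] (EFin \o
  tensor u v).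
  by apply/measurable_EFinP; apply: measurable_tensor; exact/measurable_EFinP.
have iu' := integrable_norm iu; have iv' := integrable_norm iv.
have finv : (\int[mu]_y `|(EFin \o v) y|)%E \is a fin_num.
  exact: integrable_fin_num iv'.
have it : pi.-integrable setT (EFin \o tensor u v).
  apply/(integrable12ltyP mu mu mt).
  have e x : (\int[mu]_y `|(EFin \o tensor u v) (x, y)| =
      (fine (\int[mu]_y `|(EFin \o v) y|))%:E * `|(EFin \o u) x|)%E.
    rewrite fineK// muleC -integralZl//.
    by apply: eq_integral => y _; rewrite /= /tensor/= normrM EFinM.
  under eq_integral => x _ do rewrite e.
  rewrite integralZl//.
  by rewrite lte_mul_pinfty// lee_fin fine_ge0// integral_ge0.
split => //.
have finv' : (\int[mu]_y (EFin \o v) y)%E \is a fin_num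
  by exact: integrable_fin_num.
have finu' : (\int[mu]_y (EFin \o u) y)%E \is a fin_num
  by exact: integrable_fin_num.
rewrite /Rintegral -(integral12_prod_meas1 it) -fineM//; congr fine.
have e x : (\int[mu]_y (EFin \o tensor u v) (x, y) =
    (fine (\int[mu]_y (EFin \o v) y))%:E * (EFin \o u) x)%E.
  rewrite fineK// muleC -integralZl//.
transitivity (\int[mu]_x ((fine (\int[mu]_y (EFin \o v) y))%:E * (EFin \o u)
  x))%E.
  by apply: eq_integral => x _; exact: e.
by rewrite integralZl// fineK// muleC.
Qed.

Lemma tensor_L2 u v : u \in L2 -> v \in L2 -> tensor u v \in L2p.
Proof.
move=> uL vL; apply: L2_square_integrable; first by apply: measurable_tensor;
  exact: (@L2_measurable _ _ _ mu).
have [] := tensor_integral (L2_integrable uL uL) (L2_integrable vL vL).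
move=> /integrableP[_ h] _; move: h; congr (_ < _)%E; apply: eq_integral => z _.
rewrite /= /tensor ger0_norm; first by congr EFin; ring.
by rewrite mulr_ge0// -expr2 sqr_ge0.
Qed.

Lemma ip_tensor u v u' v' : u \in L2 -> v \in L2 -> u' \in L2 -> v' \in L2 ->
  ip pi (tensor u v) (tensor u' v') = ip mu u u' * ip mu v v'.
Proof.
move=> uL vL uL' vL'.
have [_ <-] := tensor_integral (L2_integrable uL uL') (L2_integrable vL vL').
by apply: eq_Rintegral => z _; rewrite /tensor; ring.
Qed.

Definition rectangles : set (set (measurableTypeR R * measurableTypeR R)) :=
  [set A `*` B | A in @measurable _ (measurableTypeR R)
               & B in @measurable _ (measurableTypeR R)].

Lemma setI_closed_rectangles : setI_closed rectangles.
Proof.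
move=> _ _ [A mA [B mB <-]] [A' mA' [B' mB' <-]].
by rewrite -setXI; exists (A `&` A'); [exact: measurableI|exists (B `&` B') =>
  //; exact: measurableI].
Qed.

Lemma indic_setX (A B : set R) : \1_(A `*` B) =
  tensor \1_A \1_B :> (R * R -> R).
Proof. by apply/funext => -[x y]; rewrite /tensor !indicE in_setX/=;
  case: (x \in A); case: (y \in B); rewrite /= ?mulr1 ?mulr0. Qed.

Definition box2 n : set (measurableTypeR R * measurableTypeR R) := @box R n
  `*` @box R n.

(** Measurable rectangles generate the product sigma-algebra and their
   indicators are elementary tensors. *)
Lemma plane_L2functional_eq0 (F : (R * R -> R) -> R) : L2functional pi F ->
  (forall u v, u \in L2 -> v \in L2 -> F (tensor u v) = 0) ->
  forall f, f \in L2p -> F f = 0.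
Proof.
move=> LF FT.
have bL X n : measurable X -> \1_(X `&` @box R n) \in L2.
  by move=> mX; apply: sub_indic_L2 => //;
    [exact: measurable_box|exact: box_finite].
have FX X n : rectangles X -> F \1_(X `&` box2 n) = 0.
  move=> [A mA [B mB <-]]; rewrite /box2 -setXI indic_setX.
  by apply: FT; exact: bL.
apply: (@L2functional_eq0 _ _ _ pi F rectangles box2) => //.
- by move=> n; apply: measurableX; exact: measurable_box.
- move=> n; have e : pi (box2 n) = (mu (@box R n) * mu (@box R n))%E.
    by apply: product_measure1E; exact: measurable_box.
  have h := box_finite R n.
  have h' : (mu (@box R n) * mu (@box R n) < +oo)%E
    by rewrite lte_mul_pinfty// ge0_fin_numE.
  by rewrite -e in h'.
- exact: measurable_prod_measurableType.
- exact: setI_closed_rectangles.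
- by move=> m n mn; apply/subsetPset => -[x y] [/= ? ?]; split => /=;
   have /subsetPset := box_nd R mn; exact.
- apply/seteqP; split => // -[x y] _.
  have [[n _ xn] [m _ ym]] : (\bigcup_n @box R n) x /\
    (\bigcup_n @box R n) y by rewrite box_cover.
  exists (maxn n m) => //; split => /=.
    by have /subsetPset := box_nd R (leq_maxl n m); exact.
  by have /subsetPset := box_nd R (leq_maxr n m); exact.
- move=> n; rewrite -[box2 n]setTI; apply: FX.
  by exists setT => //; exists setT => //; rewrite setXTT.
Qed.

Section adjoint.
Variables (S : (R -> R) -> R -> R) (dS : dyadic_shift S).

(** On an elementary tensor this is the one-dimensional adjoint formula; by
   density it holds for every g, in particular for b f and for images of the
   operators. *)
Lemma x_adjoint T1 I v g : acting_in_x S T1 -> ~~ odd_dyadic I -> v \in L2 ->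
  g \in L2p ->
  ip pi (T1 g) (tensor (haar_shift I) v) = 2 * ip pi g (tensor (haar I) v).
Proof.
move=> [bT actT] oI vL gL; have [bS _ _] := dS; have [SL _ _] := bS;
  have [TL _ _] := bT.
have hL := tensor_L2 (haar_L2 R I) vL; have sL := tensor_L2 (haar_shift_L2 R
  I) vL.
apply/eqP; rewrite -subr_eq0; apply/eqP.
apply: (plane_L2functional_eq0 (L2functional_sub 2 (L2functional_op bT sL)
  (L2functional_ip hL))) gL => a b aL bL.
have aS := SL _ aL.
rewrite (ip_aeq (TL _ (tensor_L2 aL bL)) (tensor_L2 aS bL) sL (actT _ _ aL bL)).
have ? := haar_L2 R I; have ? := haar_shift_L2 R I.
by rewrite !ip_tensor// (shift_adjoint dS)//; ring.
Qed.

Lemma y_adjoint T2 J u g : acting_in_y S T2 -> ~~ odd_dyadic J -> u \in L2 ->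
  g \in L2p ->
  ip pi (T2 g) (tensor u (haar_shift J)) = 2 * ip pi g (tensor u (haar J)).
Proof.
move=> [bT actT] oI vL gL; have [bS _ _] := dS; have [SL _ _] := bS;
  have [TL _ _] := bT.
have hL := tensor_L2 vL (haar_L2 R J); have sL := tensor_L2 vL (haar_shift_L2
  R J).
apply/eqP; rewrite -subr_eq0; apply/eqP.
apply: (plane_L2functional_eq0 (L2functional_sub 2 (L2functional_op bT sL)
  (L2functional_ip hL))) gL => a b aL bL.
have bS' := SL _ bL.
rewrite (ip_aeq (TL _ (tensor_L2 aL bL)) (tensor_L2 aL bS') sL (actT _ _ aL
  bL)).
have ? := haar_L2 R J; have ? := haar_shift_L2 R J.
by rewrite !ip_tensor// (shift_adjoint dS)//; ring.
Qed.

End adjoint.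

End plane.

(** * Multiplication by the symbol *)

Section pairing.
Variable R : realType.
Implicit Types (I J K L : dyadic) (x y : R) (u v : R -> R).
Local Notation mu := (@lebesgue_measure R).
Local Notation pi := (plane_measure R).
Local Notation L2 := (Lfun mu 2%:E).
Local Notation L2p := (Lfun pi 2%:E).
Variables (b : R * R -> R).

Definition symbol_pairing u v : R := \int[pi]_z (b z * tensor u v z).
Definition symbol_mul (f : R * R -> R) z := b z * f z.

Section loc.
Hypothesis sb : symbol b.

Lemma haar_le I x : `|haar I x| <= (Num.sqrt (dyadic_length R I))^-1.
Proof.
rewrite haarE normrM ger0_norm; last by rewrite invr_ge0 sqrtr_ge0.
rewrite ler_piMr ?invr_ge0 ?sqrtr_ge0//.
by case: (_ == _); case: (_ == _); rewrite /= ?subrr ?subr0 ?sub0r ?normrN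
  ?normr0 ?normr1.
Qed.

(** The product is dominated by a multiple of b on the closure of the
   rectangle, where b is square integrable by local integrability. *)
Lemma symbol_mul_haar_L2 I J : symbol_mul (tensor (haar I) (haar J)) \in L2p.
Proof.
have [mb bfin] := sb.
pose C K : set R := `[K.2%:~R * dyadic_length R K,
  (K.2 + 1)%:~R * dyadic_length R K]%classic.
have cC K : compact (C K) by exact: segment_compact.
pose K := C I `*` C J.
have mK : measurable (K : set (measurableTypeR R * measurableTypeR R)).
  by apply: measurableX; exact: measurable_itv.
pose M := (Num.sqrt (dyadic_length R I))^-1 * (Num.sqrt (dyadic_length R J))^-1.
pose g z := M * (b z * \1_K z).
have gL : g \in L2p.
  apply: L2_Z; apply: L2_square_integrable.
    by apply: measurable_funM => //; exact: measurable_indic.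
  suff <- : (\int[pi]_(z in K) (b z ^+ 2)%:E =
    \int[pi]_z ((b z * \1_K z) ^+ 2)%:E)%E.
    exact: bfin (compact_setX (cC I) (cC J)).
  rewrite integral_mkcond; apply: eq_integral => z _.
  rewrite patchE indicE; case: ifPn => h; last by rewrite mulr0 expr0n.
  by rewrite mulr1.
apply: (L2_dominated gL).
  apply: measurable_funM => //; apply: measurable_tensor;
    apply: (@L2_measurable _ _ _ mu); exact: haar_L2.
move=> z; rewrite /symbol_mul /g (_ : M * (b z * \1_K z) =
  b z * (M * \1_K z)); last by ring.
rewrite normrM [leRHS]normrM; apply: ler_wpM2l => //; rewrite [leRHS]normrM.
have sub A x : haar A x != 0 -> x \in C A.
  move=> h; have e : cell A.1 x = A.2 by apply/eqP;
    apply: contraNT h => /haar_supp ->.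
  move/dyadic_setP : e; rewrite /dyadic_set /C/= in_itv/= => /andP[h1 h2].
  by rewrite inE/= in_itv/= h1 ltW.
rewrite /tensor normrM (@ger0_norm _ M); last
  by rewrite mulr_ge0// invr_ge0 sqrtr_ge0.
have [e|nz] := eqVneq (haar I z.1) 0; first
  by rewrite e normr0 mul0r mulr_ge0 ?normr_ge0// mulr_ge0// invr_ge0 sqrtr_ge0.
have [e|nz'] := eqVneq (haar J z.2) 0; first
  by rewrite e normr0 mulr0 mulr_ge0 ?normr_ge0// mulr_ge0// invr_ge0 sqrtr_ge0.
rewrite indicE (_ : z \in K) ?normr1 ?mulr1; last first.
  by move: (sub _ _ nz) (sub _ _ nz'); rewrite !inE.
by apply: ler_pM => //; exact: haar_le.
Qed.

Lemma symbol_mul_L2 P Q u v : haar_comb P u -> haar_comb Q v ->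
  symbol_mul (tensor u v) \in L2p.
Proof.
move=> hu hv; elim: hu => [|c K u' _ _ IH].
  rewrite (_ : symbol_mul _ = (fun=> 0)); first exact: L2_0.
  by apply/funext => z; rewrite /symbol_mul /tensor mul0r mulr0.
rewrite (_ : symbol_mul _ = (fun z => c * symbol_mul (tensor (haar K) v) z +
  symbol_mul (tensor u' v) z)); last first.
  by apply/funext => z; rewrite /symbol_mul /tensor; ring.
apply: L2_lin IH; elim: hv => [|d L v' _ _ IH].
  rewrite (_ : symbol_mul _ = (fun=> 0)); first exact: L2_0.
  by apply/funext => z; rewrite /symbol_mul /tensor mulr0 mulr0.
rewrite (_ : symbol_mul _ = (fun z => d * symbol_mul (tensor (haar K) (haar
  L)) z + symbol_mul (tensor (haar K) v') z)); last first.
  by apply/funext => z; rewrite /symbol_mul /tensor; ring.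
by apply: L2_lin IH; exact: symbol_mul_haar_L2.
Qed.

Lemma symbol_mul_integrable P Q u v : haar_comb P u -> haar_comb Q v ->
  pi.-integrable setT (EFin \o symbol_mul (tensor u v)).
Proof.
move=> hu hv; elim: hu => [|c K u' _ _ IH].
  rewrite (_ : EFin \o _ = cst 0%E); first exact: integrable0.
  by apply/funext => z; rewrite /symbol_mul /tensor/= mul0r mulr0.
rewrite (_ : EFin \o _ = ((fun z => c%:E * (EFin \o symbol_mul (tensor (haar
  K) v)) z) \+ (EFin \o symbol_mul (tensor u' v)))%E); last first.
  by apply/funext => z; rewrite /symbol_mul /tensor -EFinM -EFinD;
    congr EFin => /=; ring.
apply: integrableD => //; apply: integrableZl => //.
elim: hv => [|d L v' _ _ IHv].
  rewrite (_ : EFin \o _ = cst 0%E); first exact: integrable0.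
  by apply/funext => z; rewrite /symbol_mul /tensor/= mulr0 mulr0.
rewrite (_ : EFin \o _ = ((fun z => d%:E * (EFin \o symbol_mul (tensor (haar
  K) (haar L))) z) \+ (EFin \o symbol_mul (tensor (haar K) v')))%E); last first.
  by apply/funext => z; rewrite /symbol_mul /tensor -EFinM -EFinD;
    congr EFin => /=; ring.
apply: integrableD => //; apply: integrableZl => //.
have := L2_integrable (symbol_mul_haar_L2 K L) (tensor_L2 (indic_L2 R K)
  (indic_L2 R L)).
congr (_.-integrable _ _); apply/funext => z; congr EFin.
rewrite /symbol_mul /tensor !indic_dyadic -mulrA; congr (_ * _).
have [h1|h1] := eqVneq (cell K.1 z.1) K.2;
  last by rewrite (haar_supp h1) !mul0r.
have [h2|h2] := eqVneq (cell L.1 z.2) L.2;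
  last by rewrite (haar_supp h2) !(mul0r,mulr0).
by rewrite !mulr1.
Qed.

End loc.
End pairing.

(** * Pairing the symbol with products of Haar functions *)

Lemma Rintegral_lin d (T : measurableType d) (R : realType)
    (m : {measure set T -> \bar R}) (c : R) (f g : T -> R) :
  m.-integrable setT (EFin \o f) -> m.-integrable setT (EFin \o g) ->
  m.-integrable setT (EFin \o (fun x => c * f x + g x)) /\
  \int[m]_x (c * f x + g x) = c * \int[m]_x f x + \int[m]_x g x.
Proof.
move=> fi gi; have cfi : m.-integrable setT (EFin \o (fun x =>
  c * f x)) by exact: (integrableZl measurableT c fi).
split; first exact: (integrableD measurableT cfi gi).
by rewrite RintegralD// RintegralZl.
Qed.

Section symbol_pairing.
Variable R : realType.
Implicit Types (I J K L : dyadic) (x y : R) (u v : R -> R).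
Local Notation mu := (@lebesgue_measure R).
Local Notation pi := (plane_measure R).
Local Notation L2 := (Lfun mu 2%:E).
Local Notation L2p := (Lfun pi 2%:E).
Variables (b : R * R -> R).
Hypothesis sb : symbol b.
Hypothesis eb : forall I J, haar_coef b I J <> 0 -> even_dyadic R I /\
  even_dyadic R J.

Lemma symbol_pairing_linl P P' Q c u u' v : haar_comb P u ->
  haar_comb P' u' -> haar_comb Q v ->
  symbol_pairing b (fun x => c * u x + u' x) v =
    c * symbol_pairing b u v + symbol_pairing b u' v.
Proof.
move=> hu hu' hv.
have [_ <-] := Rintegral_lin c (symbol_mul_integrable sb hu hv)
  (symbol_mul_integrable sb hu' hv).
by apply: eq_Rintegral => z _; rewrite /symbol_mul /tensor; ring.
Qed.

Lemma symbol_pairing_linr P Q Q' c u v v' : haar_comb P u -> haar_comb Q v ->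
  haar_comb Q' v' ->
  symbol_pairing b u (fun x => c * v x + v' x) =
    c * symbol_pairing b u v + symbol_pairing b u v'.
Proof.
move=> hu hv hv'.
have [_ <-] := Rintegral_lin c (symbol_mul_integrable sb hu hv)
  (symbol_mul_integrable sb hu hv').
by apply: eq_Rintegral => z _; rewrite /symbol_mul /tensor; ring.
Qed.

Lemma symbol_pairing0l v : symbol_pairing b (fun=> 0) v = 0.
Proof.
by rewrite /symbol_pairing /Rintegral integral0_eq// => z _;
  rewrite /tensor mul0r mulr0.
Qed.

Lemma symbol_pairing0r u : symbol_pairing b u (fun=> 0) = 0.
Proof.
by rewrite /symbol_pairing /Rintegral integral0_eq// => z _;
  rewrite /tensor !mulr0.
Qed.

Lemma haar_coef_odd I J : odd_dyadic I || odd_dyadic J ->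
  symbol_pairing b (haar I) (haar J) = 0.
Proof.
move=> o; apply: contrapT => /eb[/even_dyadicP eI /even_dyadicP eJ].
by move: o; rewrite (negbTE eI) (negbTE eJ).
Qed.

Lemma symbol_pairing_odd P Q u v : (forall I J,
  P I -> Q J -> odd_dyadic I || odd_dyadic J) ->
  haar_comb P u -> haar_comb Q v -> symbol_pairing b u v = 0.
Proof.
move=> PQ; elim=> [|c K u' PK hu' IH] hv; first exact: symbol_pairing0l.
rewrite (symbol_pairing_linl c (haar_comb1 R PK) hu' hv) IH// addr0.
apply/eqP; rewrite mulf_eq0; apply/orP; right; apply/eqP.
elim: hv => [|d L v' QL hv' IHv]; first exact: symbol_pairing0r.
rewrite (symbol_pairing_linr d (haar_comb1 R PK) (haar_comb1 R QL) hv') IHv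
  addr0 haar_coef_odd ?mulr0//.
exact: PQ.
Qed.

(** The one-variable function against which b is integrated when the commutator
   of b with the shift is applied to h_K and paired with the shifted h_I. *)
Definition pairing_factor I K x : R :=
  2 * (haar K x * haar I x) - haar_shift K x * haar_shift I x.

(** The product h_K h_I with its diagonal removed; unlike h_I^2, it is a finite
   combination of Haar functions. *)
Definition offdiag_product I K x : R :=
  if K == I then 0 else haar K x * haar I x.

Lemma offdiag_product_comb I K : haar_comb xpredT (offdiag_product I K).
Proof.
have [e|KI] := eqVneq K I.
  by apply: eq_haar_comb (haar_comb0 _ _) _ => x;
    rewrite /offdiag_product e eqxx.
apply: eq_haar_comb (haar_mul_comb R KI (P := xpredT) isT isT) _ => x.
by rewrite /offdiag_product (negbTE KI).
Qed.

(** The remainder is the product of two shifted Haar functions, off the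
   diagonal; on the diagonal everything cancels. *)
Lemma pairing_factor_odd I K : ~~ odd_dyadic I -> exists2 o,
  haar_comb odd_dyadic o &
  pairing_factor I K = (fun x => 2 * offdiag_product I K x + o x).
Proof.
move=> oI; have [->|KI] := eqVneq K I.
  exists (fun=> 0); first exact: haar_comb0.
  by apply/funext => x; rewrite /pairing_factor haar_shift_sq//
    /offdiag_product eqxx mulr0 addr0.
exists (fun x => -1 * (haar_shift K x * haar_shift I x)).
  exact: haar_combZ (haar_shift_mul_comb R KI).
by apply/funext => x; rewrite /pairing_factor /offdiag_product (negbTE KI);
  ring.
Qed.

(** The odd remainders are orthogonal to b in either variable, as the
   coefficients of b live on pairs of even intervals. *)
Lemma symbol_pairing_factor I J K L : ~~ odd_dyadic I -> ~~ odd_dyadic J ->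
  symbol_pairing b (pairing_factor I K) (pairing_factor J L) =
    4 * symbol_pairing b (offdiag_product I K) (offdiag_product J L).
Proof.
move=> oI oJ; case: (pairing_factor_odd K oI) => o ho ->;
  case: (pairing_factor_odd L oJ) => p hp ->.
have hq := offdiag_product_comb I K; have hr := offdiag_product_comb J L.
have hw := haar_comb_lin 2 hr (@haar_comb_weaken R _ xpredT _ (fun _ _ =>
  isT) hp).
rewrite (symbol_pairing_linl 2 hq ho hw) (symbol_pairing_odd _ ho hw) ?addr0;
  last by move=> ? ? ->.
rewrite (symbol_pairing_linr 2 hq hr hp) (symbol_pairing_odd _ hq hp) ?addr0;
  first by ring.
by move=> ? ? _ ->; rewrite orbT.
Qed.

(** With f and g the Haar functions this is a general element of the Haar span;
   the other choices describe its images under the shifts. *)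
Definition tensor_sum (s : seq (R * (dyadic * dyadic))) (f g : dyadic -> R -> R)
    (z : R * R) : R :=
  \sum_(t <- s) t.1 * tensor (f t.2.1) (g t.2.2) z.

Lemma tensor_sum_cons t s f g :
  tensor_sum (t :: s) f g = (fun z => t.1 * tensor (f t.2.1) (g t.2.2) z +
    tensor_sum s f g z).
Proof. by apply/funext => z; rewrite /tensor_sum big_cons. Qed.

Lemma tensor_sum_nil f g : tensor_sum [::] f g = (fun=> 0).
Proof. by apply/funext => z; rewrite /tensor_sum big_nil. Qed.

Lemma tensor_sum_L2 s f g : (forall K, f K \in L2) -> (forall K,
  g K \in L2) -> tensor_sum s f g \in L2p.
Proof.
move=> fL gL; elim: s => [|t s IH]; first by rewrite tensor_sum_nil;
  exact: L2_0.
by rewrite tensor_sum_cons; apply: L2_lin IH; exact: tensor_L2.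
Qed.

Lemma haar_combT P u : haar_comb P u -> haar_comb xpredT u.
Proof. by apply: haar_comb_weaken. Qed.

Lemma symbol_mul_tensor_sum_L2 s (f g : dyadic -> R -> R) : (forall K,
  haar_comb xpredT (f K)) ->
  (forall K, haar_comb xpredT (g K)) -> symbol_mul b (tensor_sum s f g) \in L2p.
Proof.
move=> hf hg; elim: s => [|t s IH].
  rewrite (_ : symbol_mul _ _ = (fun=> 0)); first exact: L2_0.
  by apply/funext => z; rewrite /symbol_mul tensor_sum_nil mulr0.
rewrite (_ : symbol_mul _ _ = (fun z => t.1 * symbol_mul b (tensor (f t.2.1)
  (g t.2.2)) z + symbol_mul b (tensor_sum s f g) z)).
  by apply: L2_lin IH; exact: symbol_mul_L2 (hf _) (hg _).
by apply/funext => z; rewrite tensor_sum_cons /symbol_mul; ring.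
Qed.

Lemma ip_symbol_mul_tensor_sum s (f g : dyadic -> R -> R) u v : (forall K,
  haar_comb xpredT (f K)) ->
  (forall K, haar_comb xpredT (g K)) -> u \in L2 -> v \in L2 ->
  ip pi (symbol_mul b (tensor_sum s f g)) (tensor u v) =
  \sum_(t <- s) t.1 * ip pi (symbol_mul b (tensor (f t.2.1) (g t.2.2)))
    (tensor u v).
Proof.
move=> hf hg uL vL.
have [//|_ <-] := @L2functional_sum _ _ _ pi _ _ s (fun t => t.1) (fun t =>
  symbol_mul b (tensor (f t.2.1) (g t.2.2))) (L2functional_ip (tensor_L2 uL
  vL)).
  by move=> t; exact: symbol_mul_L2 (hf _) (hg _).
congr ip; apply/funext => z; rewrite /symbol_mul /tensor_sum mulr_sumr.
by apply: eq_bigr => t _; ring.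
Qed.

End symbol_pairing.

(** * The repeated commutator against shifted Haar functions *)

Section commutator.
Variable R : realType.
Implicit Types (I J K L : dyadic) (x y : R) (u v : R -> R).
Local Notation mu := (@lebesgue_measure R).
Local Notation pi := (plane_measure R).
Local Notation L2 := (Lfun mu 2%:E).
Local Notation L2p := (Lfun pi 2%:E).
Variables (S : (R -> R) -> R -> R) (T1 T2 : (R * R -> R) -> R * R -> R).
Hypotheses (dS : dyadic_shift S) (aT1 : acting_in_x S T1) (aT2 : acting_in_y S
  T2).

Lemma tensor_aeq u u' v v' : u \in L2 -> u' \in L2 -> v \in L2 -> v' \in L2 ->
  {ae mu, forall x, u x = u' x} -> {ae mu, forall x, v x = v' x} ->
  {ae pi, forall z, tensor u v z = tensor u' v' z}.
Proof.
move=> uL uL' vL vL' uu vv.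
have tL := tensor_L2 uL vL; have tL' := tensor_L2 uL' vL'.
have dL := L2_lin (-1) tL tL'.
suff : ip pi (fun z => -1 * tensor u v z + tensor u' v' z) (fun z =>
  -1 * tensor u v z + tensor u' v' z) = 0.
  move/(ip_eq0 dL); apply: ae_imp => z /eqP.
  by rewrite mulN1r addrC subr_eq0 => /eqP.
rewrite ip_linear// ![ip pi _ (fun z => _ + _)]ipC !ip_linear// !ip_tensor//.
rewrite (ip_aeq uL uL' uL uu) (ip_aeq uL uL' uL' uu) (ip_aeq vL vL' vL vv)
  (ip_aeq vL vL' vL' vv).
rewrite (ipC mu u' u) (ipC mu v' v) (ip_aeq uL uL' uL' uu) (ip_aeq vL vL' vL'
  vv).
by ring.
Qed.

Lemma T1_tensor_sum s (g : dyadic -> R -> R) : (forall K, g K \in L2) ->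
  {ae pi, forall z, T1 (tensor_sum s (@haar R) g) z =
    tensor_sum s (@haar_shift R) g z}.
Proof.
move=> gL; have [bT actT] := aT1; have [_ Tlin _] := bT.
have [[SL _ _] _ _] := dS.
elim: s => [|t s IH].
  by rewrite !tensor_sum_nil; exact: bounded_0.
rewrite !tensor_sum_cons.
have h1 := Tlin t.1 _ _ (tensor_L2 (haar_L2 R t.2.1) (gL t.2.2))
  (tensor_sum_L2 s (haar_L2 R) gL).
have h2 := actT _ _ (haar_L2 R t.2.1) (gL t.2.2).
have h3 : {ae pi, forall z, tensor (S (haar t.2.1)) (g t.2.2) z =
  tensor (haar_shift t.2.1) (g t.2.2) z}.
  apply: tensor_aeq => //; [exact: SL (haar_L2 R _)|exact:
    haar_shift_L2|exact: dyadic_shift_haar|].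
  exact: aeW.
have h4 := ae_imp2 (fun z (e1 : _ = _) (e2 : _ = _) => etrans e1 e2) h2 h3.
have h5 := ae_imp2 (fun z (e1 : _ = _) (e2 : _ = _) => conj e1 e2) h4 IH.
by apply: ae_imp2 h1 h5 => z -> [-> ->].
Qed.

Lemma T2_tensor_sum s (f : dyadic -> R -> R) : (forall K, f K \in L2) ->
  {ae pi, forall z, T2 (tensor_sum s f (@haar R)) z =
    tensor_sum s f (@haar_shift R) z}.
Proof.
move=> fL; have [bT actT] := aT2; have [_ Tlin _] := bT.
have [[SL _ _] _ _] := dS.
elim: s => [|t s IH].
  by rewrite !tensor_sum_nil; exact: bounded_0.
rewrite !tensor_sum_cons.
have h1 := Tlin t.1 _ _ (tensor_L2 (fL t.2.1) (haar_L2 R t.2.2))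
  (tensor_sum_L2 s fL (haar_L2 R)).
have h2 := actT _ _ (fL t.2.1) (haar_L2 R t.2.2).
have h3 : {ae pi, forall z, tensor (f t.2.1) (S (haar t.2.2)) z =
  tensor (f t.2.1) (haar_shift t.2.2) z}.
  apply: tensor_aeq => //; [exact: SL (haar_L2 R _)|exact:
    haar_shift_L2|exact: aeW|].
  exact: dyadic_shift_haar.
have h4 := ae_imp2 (fun z (e1 : _ = _) (e2 : _ = _) => etrans e1 e2) h2 h3.
have h5 := ae_imp2 (fun z (e1 : _ = _) (e2 : _ = _) => conj e1 e2) h4 IH.
by apply: ae_imp2 h1 h5 => z -> [-> ->].
Qed.

Variable b : R * R -> R.
Hypothesis sb : symbol b.

Lemma symbol_mul_aeq f g : f \in L2p -> symbol_mul b g \in L2p ->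
  {ae pi, forall z, f z = g z} ->
  symbol_mul b f \in L2p /\ {ae pi, forall z,
    symbol_mul b f z = symbol_mul b g z}.
Proof.
move=> fL bgL fg.
have e : {ae pi, forall z, symbol_mul b f z = symbol_mul b g z}.
  by apply: ae_imp fg => z fgz; rewrite /symbol_mul fgz.
split => //; apply: L2_aeq bgL _ e.
by apply: measurable_funM; [have [] := sb|exact: L2_measurable fL].
Qed.

Let haar_all K : haar_comb xpredT (@haar R K). Proof. exact: haar_comb1. Qed.
Let haar_shift_all K : haar_comb xpredT (@haar_shift R K).
Proof. exact: haar_combT (haar_shift_comb R K). Qed.

Lemma commutator_L2 s : let f := tensor_sum s (@haar R) (@haar R) in
  [/\ T2 (T1 (symbol_mul b f)) \in L2p, T2 (symbol_mul b (T1 f)) \in L2p,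
      T1 (symbol_mul b (T2 f)) \in L2p & symbol_mul b (T1 (T2 f)) \in L2p].
Proof.
move=> f; have [bT1 _] := aT1; have [bT2 _] := aT2.
have [TL1 _ _] := bT1; have [TL2 _ _] := bT2.
have fL : f \in L2p := tensor_sum_L2 s (haar_L2 R) (haar_L2 R).
have bL f' g' := symbol_mul_tensor_sum_L2 sb s (f := f') (g := g').
have [h1 _] := symbol_mul_aeq (TL1 _ fL) (bL _ _ haar_shift_all haar_all)
  (T1_tensor_sum s (haar_L2 R)).
have [h2 _] := symbol_mul_aeq (TL2 _ fL) (bL _ _ haar_all haar_shift_all)
  (T2_tensor_sum s (haar_L2 R)).
have T12 : {ae pi, forall z, T1 (T2 f) z = tensor_sum s (@haar_shift R)
  (@haar_shift R) z}.
  have e := bounded_aeq bT1 (TL2 _ fL) (tensor_sum_L2 s (haar_L2 R)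
    (haar_shift_L2 R)) (T2_tensor_sum s (haar_L2 R)).
  exact: ae_imp2 (fun z (e1 : _ = _) (e2 : _ = _) =>
    etrans e1 e2) e (T1_tensor_sum s (haar_shift_L2 R)).
have [h3 _] := symbol_mul_aeq (TL1 _ (TL2 _ fL)) (bL _ _ haar_shift_all
  haar_shift_all) T12.
split => //; [apply: TL2; apply: TL1|exact: TL2|exact: TL1].
exact: bL haar_all haar_all.
Qed.

Lemma repeated_commutator_L2 s :
  repeated_commutator T1 T2 b (tensor_sum s (@haar R) (@haar R)) \in L2p.
Proof.
have [h1 h2 h3 h4] := commutator_L2 s.
have h := L2_lin (-1) h2 (L2_lin (-1) h3 (L2_lin 1 h1 h4)).
suff <- : (fun z => -1 * T2 (symbol_mul b (T1 (tensor_sum s (@haar R) (@haar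
  R)))) z + (-1 * T1 (symbol_mul b (T2 (tensor_sum s (@haar R) (@haar R)))) z
  + (1 * T2 (T1 (symbol_mul b (tensor_sum s (@haar R) (@haar R)))) z +
  symbol_mul b (T1 (T2 (tensor_sum s (@haar R) (@haar R)))) z))) =
  repeated_commutator T1 T2 b (tensor_sum s (@haar R) (@haar R)) by [].
by apply/funext => z; rewrite /repeated_commutator /symbol_mul /=; ring.
Qed.

(** Moving each shift to the other side by the adjoint formulas, the four
   terms of the commutator become the expansion of a product of two pairing
   factors. *)
Lemma commutator_pairing s I J : ~~ odd_dyadic I -> ~~ odd_dyadic J ->
  ip pi (repeated_commutator T1 T2 b (tensor_sum s (@haar R) (@haar R)))
    (tensor (haar_shift I) (haar_shift J)) =
  \sum_(t <- s) t.1 * symbol_pairing b (@pairing_factor R I t.2.1)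
    (@pairing_factor R J t.2.2).
Proof.
move=> oI oJ; set f := tensor_sum s _ _.
have [bT1 _] := aT1; have [bT2 _] := aT2.
have [TL1 _ _] := bT1; have [TL2 _ _] := bT2.
have fL : f \in L2p := tensor_sum_L2 s (haar_L2 R) (haar_L2 R).
have bL f' g' := symbol_mul_tensor_sum_L2 sb s (f := f') (g := g').
have [h1 e1] := symbol_mul_aeq (TL1 _ fL) (bL _ _ haar_shift_all haar_all)
  (T1_tensor_sum s (haar_L2 R)).
have [h2 e2] := symbol_mul_aeq (TL2 _ fL) (bL _ _ haar_all haar_shift_all)
  (T2_tensor_sum s (haar_L2 R)).
have T12 : {ae pi, forall z, T1 (T2 f) z = tensor_sum s (@haar_shift R)
  (@haar_shift R) z}.
  have e := bounded_aeq bT1 (TL2 _ fL) (tensor_sum_L2 s (haar_L2 R)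
    (haar_shift_L2 R)) (T2_tensor_sum s (haar_L2 R)).
  exact: ae_imp2 (fun z (e1 : _ = _) (e2 : _ = _) =>
    etrans e1 e2) e (T1_tensor_sum s (haar_shift_L2 R)).
have [h3 e3] := symbol_mul_aeq (TL1 _ (TL2 _ fL)) (bL _ _ haar_shift_all
  haar_shift_all) T12.
have h0 := bL _ _ haar_all haar_all.
have hI := haar_L2 R I; have hJ := haar_L2 R J.
have sI := haar_shift_L2 R I; have sJ := haar_shift_L2 R J.
have ssL := tensor_L2 sI sJ.
set e := tensor (haar_shift I) (haar_shift J).
have -> : repeated_commutator T1 T2 b f = (fun z =>
  -1 * T2 (symbol_mul b (T1 f)) z +
    (-1 * T1 (symbol_mul b (T2 f)) z + (1 * T2 (T1 (symbol_mul b f)) z +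
      symbol_mul b (T1 (T2 f)) z))).
  by apply/funext => z; rewrite /repeated_commutator /symbol_mul /=; ring.
have [g1 g2 g3 g4] := commutator_L2 s.
rewrite ip_linear//; last by apply: L2_lin => //; exact: L2_lin.
rewrite ip_linear//; last exact: L2_lin.
rewrite ip_linear// /e.
rewrite (y_adjoint dS aT2 oJ sI (TL1 _ h0)) (x_adjoint dS aT1 oI hJ h0).
rewrite (y_adjoint dS aT2 oJ sI h1) (x_adjoint dS aT1 oI sJ h2).
rewrite (ip_aeq h1 (bL _ _ haar_shift_all haar_all) (tensor_L2 sI hJ) e1).
rewrite (ip_aeq h2 (bL _ _ haar_all haar_shift_all) (tensor_L2 hI sJ) e2).
rewrite (ip_aeq h3 (bL _ _ haar_shift_all haar_shift_all) ssL e3).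
rewrite !(ip_symbol_mul_tensor_sum sb)// !mulr_sumr -!big_split/=;
  apply: eq_bigr => t _.
set K := t.2.1; set L := t.2.2.
have B f' g' : haar_comb xpredT f' -> haar_comb xpredT g' ->
  symbol_mul b (tensor f' g') \in L2p.
  by move=> hf hg; exact: symbol_mul_L2 hf hg.
have i1 := L2_integrable (B _ _ (haar_shift_all K) (haar_all L)) (tensor_L2 sI
  hJ).
have i2 := L2_integrable (B _ _ (haar_all K) (haar_shift_all L)) (tensor_L2 hI
  sJ).
have i3 := L2_integrable (B _ _ (haar_all K) (haar_all L)) (tensor_L2 hI hJ).
have i4 := L2_integrable (B _ _ (haar_shift_all K) (haar_shift_all L))
  (tensor_L2 sI sJ).
have [j3 k3] := Rintegral_lin 4 i3 i4.
have [j2 k2] := Rintegral_lin (-2) i2 j3.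
have [j1 k1] := Rintegral_lin (-2) i1 j2.
have -> : symbol_pairing b (@pairing_factor R I K) (@pairing_factor R J L) =
   -2 * ip pi (symbol_mul b (tensor (haar_shift K) (haar L))) (tensor
     (haar_shift I) (haar J))
   + (-2 * ip pi (symbol_mul b (tensor (haar K) (haar_shift L))) (tensor (haar
     I) (haar_shift J))
   + (4 * ip pi (symbol_mul b (tensor (haar K) (haar L))) (tensor (haar I)
     (haar J))
    + ip pi (symbol_mul b (tensor (haar_shift K) (haar_shift L))) (tensor
      (haar_shift I) (haar_shift J)))).
  rewrite /ip -k3 -k2 -k1; apply: eq_Rintegral => z _.
  by rewrite /symbol_mul /tensor /pairing_factor; ring.
by ring.
Qed.

End commutator.

(** * Recovering a Haar coefficient of the symbol *)

Section key.
Variable R : realType.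
Implicit Types (I J K L : dyadic) (x y : R) (u v : R -> R).
Local Notation mu := (@lebesgue_measure R).
Local Notation pi := (plane_measure R).
Local Notation L2 := (Lfun mu 2%:E).
Local Notation L2p := (Lfun pi 2%:E).
Implicit Type s : seq (R * (dyadic * dyadic)).
Local Notation haar_sum s := (tensor_sum s (@haar R) (@haar R)).

Lemma offdiag_productE I K x : offdiag_product I K x =
  (haar K x - (K == I)%:R * haar I x) * haar I x.
Proof.
by rewrite /offdiag_product; have [->|_] := eqVneq K I;
  [rewrite mul1r subrr mul0r|rewrite mul0r subr0].
Qed.

(** For fixed y the sum is the coefficient of h_I in the section of the Haar
   sum at height y; that section is constant on I, and h_I has mean zero. *)
Lemma coef_sum_x s I y :
  (forall x, cell I.1 x = I.2 -> haar_sum s (x, y) = 1) ->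
  \sum_(t <- s) t.1 * (t.2.1 == I)%:R * haar t.2.2 y = 0.
Proof.
move=> h; rewrite -[RHS](ip_haar_indic R I).
have [|_ e] := @L2functional_sum _ _ _ mu _ _ s (fun t =>
  t.1 * haar t.2.2 y) (fun t => haar t.2.1)
  (L2functional_ip (haar_L2 R I)).
  by move=> t; exact: haar_L2.
transitivity (\sum_(t <- s) (t.1 * haar t.2.2 y) * ip mu (haar t.2.1) (haar I)).
  by apply: eq_bigr => t _; rewrite ip_haar; ring.
rewrite -e [RHS]ipC; apply: eq_Rintegral => x _.
have [xI|xI] := eqVneq (cell I.1 x) I.2; last by rewrite haar_supp// !mulr0.
rewrite indic_dyadic xI eqxx (_ : true%:R = haar_sum s (x, y));
  last (by rewrite h); congr (_ * _).
by rewrite /tensor_sum; apply: eq_bigr => t _; rewrite /tensor/=; ring.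
Qed.

Lemma coef_sum_y s J x :
  (forall y, cell J.1 y = J.2 -> haar_sum s (x, y) = 1) ->
  \sum_(t <- s) t.1 * (t.2.2 == J)%:R * haar t.2.1 x = 0.
Proof.
move=> h; rewrite -[RHS](ip_haar_indic R J).
have [|_ e] := @L2functional_sum _ _ _ mu _ _ s (fun t =>
  t.1 * haar t.2.1 x) (fun t => haar t.2.2)
  (L2functional_ip (haar_L2 R J)).
  by move=> t; exact: haar_L2.
transitivity (\sum_(t <- s) (t.1 * haar t.2.1 x) * ip mu (haar t.2.2) (haar J)).
  by apply: eq_bigr => t _; rewrite ip_haar; ring.
rewrite -e [RHS]ipC; apply: eq_Rintegral => y _.
have [yJ|yJ] := eqVneq (cell J.1 y) J.2; last by rewrite haar_supp// !mulr0.
rewrite indic_dyadic yJ eqxx (_ : true%:R = haar_sum s (x, y));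
  last (by rewrite h); congr (_ * _).
by rewrite /tensor_sum; apply: eq_bigr => t _; rewrite /tensor/=; ring.
Qed.

Lemma coef_sum_xy s I J :
  (forall x y, cell I.1 x = I.2 -> cell J.1 y = J.2 -> haar_sum s (x, y) = 1) ->
  \sum_(t <- s) t.1 * (t.2.1 == I)%:R * (t.2.2 == J)%:R = 0.
Proof.
move=> h.
have [|_ e] := @L2functional_sum _ _ _ mu _ _ s (fun t =>
  t.1 * (t.2.1 == I)%:R) (fun t => haar t.2.2)
  (L2functional_ip (haar_L2 R J)).
  by move=> t; exact: haar_L2.
transitivity (\sum_(t <- s) (t.1 * (t.2.1 == I)%:R) * ip mu (haar t.2.2) (haar
  J)).
  by apply: eq_bigr => t _; rewrite ip_haar.
rewrite -e -[RHS](ip0 mu (haar J)); apply: eq_Rintegral => y _.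
have [yJ|yJ] := eqVneq (cell J.1 y) J.2; last by rewrite haar_supp// !mulr0.
by rewrite coef_sum_x// => x xI; exact: h.
Qed.

(** Restoring the diagonal gives the Haar sum times h_I h_J, that is h_I h_J;
   the diagonal terms are the coefficients of a function constant on I x J, so
   they vanish there. *)
Lemma tensor_sum_offdiag_product s I J :
  (forall x y, cell I.1 x = I.2 -> cell J.1 y = J.2 -> haar_sum s (x, y) = 1) ->
  forall z, tensor_sum s (@offdiag_product R I) (@offdiag_product R J) z =
    tensor (haar I) (haar J) z.
Proof.
move=> h [x y]; rewrite /tensor/=.
transitivity ((\sum_(t <- s) t.1 * ((haar t.2.1 x - (t.2.1 == I)%:R * haar I
  x) *
    (haar t.2.2 y - (t.2.2 == J)%:R * haar J y))) * (haar I x * haar J y)).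
  by rewrite /tensor_sum mulr_suml; apply: eq_bigr => t _;
    rewrite /tensor !offdiag_productE/=; ring.
have [xI|xI] := eqVneq (cell I.1 x) I.2; last
  by rewrite (haar_supp xI) mul0r mulr0.
have [yJ|yJ] := eqVneq (cell J.1 y) J.2; last by rewrite (haar_supp yJ) !mulr0.
rewrite -[RHS]mul1r; congr (_ * _).
transitivity (haar_sum s (x, y) - haar J y * (\sum_(t <- s) t.1 * (t.2.2 ==
  J)%:R * haar t.2.1 x)
   - haar I x * (\sum_(t <- s) t.1 * (t.2.1 == I)%:R * haar t.2.2 y)
   + haar I x * haar J y * (\sum_(t <- s) t.1 * (t.2.1 == I)%:R * (t.2.2 ==
     J)%:R)).
  rewrite /tensor_sum !mulr_sumr -!sumrN -!big_split; apply: eq_bigr => t _.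
  by rewrite /tensor/=; ring.
rewrite coef_sum_x ?coef_sum_y ?coef_sum_xy// ?h//; first by ring.
- by move=> y' yJ'; exact: h.
- by move=> x' xI'; exact: h.
Qed.

Variable b : R * R -> R.
Hypothesis sb : symbol b.
Hypothesis eb : forall I J, haar_coef b I J <> 0 -> even_dyadic R I /\
  even_dyadic R J.

Lemma symbol_pairing_tensor_sum s (f g : dyadic -> R -> R) : (forall K,
  haar_comb xpredT (f K)) ->
  (forall K, haar_comb xpredT (g K)) ->
  pi.-integrable setT (EFin \o symbol_mul b (tensor_sum s f g)) /\
  \int[pi]_z symbol_mul b (tensor_sum s f g) z =
    \sum_(t <- s) t.1 * symbol_pairing b (f t.2.1) (g t.2.2).
Proof.
move=> hf hg; elim: s => [|t s [IH1 IH2]].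
  have -> : symbol_mul b (tensor_sum [::] f g) = (fun=> 0).
    by apply/funext => z; rewrite /symbol_mul tensor_sum_nil mulr0.
  split; first exact: integrable0.
  by rewrite big_nil /Rintegral integral0.
have -> : symbol_mul b (tensor_sum (t :: s) f g) =
    (fun z => t.1 * symbol_mul b (tensor (f t.2.1) (g t.2.2)) z + symbol_mul b
      (tensor_sum s f g) z).
  by apply/funext => z; rewrite /symbol_mul tensor_sum_cons; ring.
have [h1 h2] := Rintegral_lin t.1 (symbol_mul_integrable sb (hf t.2.1) (hg
  t.2.2)) IH1.
by split => //; rewrite h2 IH2 big_cons.
Qed.

Variables (S : (R -> R) -> R -> R) (T1 T2 : (R * R -> R) -> R * R -> R).
Hypotheses (dS : dyadic_shift S) (aT1 : acting_in_x S T1) (aT2 : acting_in_y S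
  T2).

(** The key identity: on a rectangle where the test function equals 1, the
   commutator reads off the Haar coefficient of b exactly. *)
Lemma commutator_coef s I J : ~~ odd_dyadic I -> ~~ odd_dyadic J ->
  (forall x y, cell I.1 x = I.2 -> cell J.1 y = J.2 -> haar_sum s (x, y) = 1) ->
  ip pi (repeated_commutator T1 T2 b (haar_sum s)) (tensor (haar_shift I)
    (haar_shift J)) =
  4 * haar_coef b I J.
Proof.
move=> oI oJ h; rewrite (commutator_pairing dS aT1 aT2 sb)//.
rewrite (eq_bigr (fun t => 4 * (t.1 * symbol_pairing b (@offdiag_product R I
  t.2.1) (@offdiag_product R J t.2.2)))); last first.
  by move=> t _; rewrite (symbol_pairing_factor sb eb)//; ring.
rewrite -mulr_sumr; congr (_ * _).
have [_ <-] := symbol_pairing_tensor_sum s (offdiag_product_comb R I)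
  (offdiag_product_comb R J).
by apply: eq_Rintegral => z _; rewrite /symbol_mul tensor_sum_offdiag_product.
Qed.

End key.

(** * A finite Haar sum equal to one on a dyadic open set *)

Section test_function.
Variable R : realType.
Implicit Types (I J K L : dyadic) (x y : R) (u v : R -> R).
Local Notation mu := (@lebesgue_measure R).
Local Notation pi := (plane_measure R).
Local Notation L2 := (Lfun mu 2%:E).
Local Notation L2p := (Lfun pi 2%:E).
Local Notation haar_sum s := (tensor_sum s (@haar R) (@haar R)).

Definition haar_spanned (f : R * R -> R) := exists s, f = haar_sum s.

Lemma haar_spanned0 : haar_spanned (fun=> 0).
Proof. by exists [::]; rewrite tensor_sum_nil. Qed.

Lemma haar_spanned_lin c f g : haar_spanned f -> haar_spanned g ->
  haar_spanned (fun z => c * f z + g z).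
Proof.
move=> [s ->] [r ->]; exists ([seq (c * t.1, t.2) | t <- s] ++ r).
apply/funext => z; rewrite /tensor_sum big_cat big_map mulr_sumr; congr (_ + _).
by apply: eq_bigr => t _ /=; rewrite mulrA.
Qed.

Lemma haar_spanned_tensor P Q u v : haar_comb P u -> haar_comb Q v ->
  haar_spanned (tensor u v).
Proof.
move=> hu hv; elim: hu => [|c K u' _ _ IH].
  rewrite (_ : tensor _ _ = fun=> 0); first exact: haar_spanned0.
  by apply/funext => z; rewrite /tensor mul0r.
rewrite (_ : tensor _ _ = fun z => c * tensor (haar K) v z + tensor u' v z);
  last first.
  by apply/funext => z; rewrite /tensor; ring.
apply: haar_spanned_lin IH; elim: hv => [|d L v' _ _ IHv].
  rewrite (_ : tensor _ _ = fun=> 0); first exact: haar_spanned0.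
  by apply/funext => z; rewrite /tensor mulr0.
rewrite (_ : tensor _ _ = fun z => d * tensor (haar K) (haar L) z + tensor
  (haar K) v' z); last first.
  by apply/funext => z; rewrite /tensor; ring.
apply: haar_spanned_lin IHv; exists [:: (1, (K, L))].
by apply/funext => z; rewrite /tensor_sum big_seq1 mul1r.
Qed.

Lemma haar_spanned_sum (X : Type) (r : seq X) (F : X -> R * R -> R) :
  (forall i, haar_spanned (F i)) -> haar_spanned (fun z =>
    \sum_(i <- r) 1 * F i z).
Proof.
move=> sF; elim: r => [|i r IH].
  rewrite (_ : (fun z => _) = fun=> 0); first exact: haar_spanned0.
  by apply/funext => z; rewrite big_nil.
rewrite (_ : (fun z => _) = fun z => 1 * F i z + \sum_(j <- r) 1 * F j z).
  exact: haar_spanned_lin.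
by apply/funext => z; rewrite big_cons.
Qed.

(** The size of r counts the rectangles used, so norms of sums over the same
   rectangles are compared without evaluating them. *)
Lemma ip_orthogonal_tensors (X : eqType) (phi : X -> R -> R) (c : R)
    (r : seq (X * X)) :
  (forall i, phi i \in L2) ->
  (forall i j, ip mu (phi i) (phi j) = c * (i == j)%:R) ->
  uniq r ->
  let f z := \sum_(p <- r) 1 * tensor (phi p.1) (phi p.2) z in
  f \in L2p /\ ip pi f f = c ^+ 2 * (size r)%:R.
Proof.
move=> phiL phio ur f.
pose t (p : X * X) := tensor (phi p.1) (phi p.2).
have tL p : t p \in L2p by exact: tensor_L2.
have [//|fL _] := @L2functional_sum _ _ _ pi _ _ r (fun=> 1) t
  (L2functional_ip (L2_0 pi)).
split => //.
have lin h : h \in L2p -> ip pi f h = \sum_(p <- r) 1 * ip pi (t p) h.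
  by move=> hL; have [//|_ <-] := @L2functional_sum _ _ _ pi _ _ r (fun=> 1) t
    (L2functional_ip hL).
rewrite lin// (eq_big_seq (fun=> c ^+ 2)); last first.
  move=> p pr; rewrite mul1r ipC lin// (bigD1_seq p)//= big1 ?addr0.
    by rewrite ip_tensor// !phio !eqxx /=; ring.
  move=> q qp; rewrite ip_tensor// !phio mul1r.
  have [e1|_] := eqVneq q.1 p.1; last by rewrite mulr0 mul0r.
  have [e2|_] := eqVneq q.2 p.2; last by rewrite !mulr0.
  by move: qp; rewrite [q]surjective_pairing [p]surjective_pairing e1 e2 eqxx.
by rewrite big_const_seq count_predT iter_addr addr0 mulr_natr.
Qed.

Lemma exists_scale (s : seq (dyadic * dyadic)) :
  exists n : int, forall Q, Q \in s -> Q.1.1 <= n /\ Q.2.1 <= n.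
Proof.
elim: s => [|Q s [n IH]]; first by exists 0.
exists (Num.max n (Num.max Q.1.1 Q.2.1)) => Q';
  rewrite inE => /predU1P[->|/IH [h1 h2]].
  by rewrite !le_max !lexx !orbT.
by rewrite !le_max h1 h2.
Qed.

Lemma dyadic_bounded (n : int) I : exists M : nat, forall x, cell I.1 x = I.2 ->
  (- M%:Z <= cell n x < M%:Z)%R.
Proof.
pose a := I.2%:~R * dyadic_length R I; pose c := (I.2 + 1)%:~R * dyadic_length
  R I.
exists (`|cell n a| + `|cell n c|).+1 => x /dyadic_setP.
rewrite /dyadic_set /= in_itv/= -/a -/c => /andP[ax xc].
have h1 : cell n a <= cell n x by rewrite le_floor// ler_wpM2r// exprz_ge0.
have h2 : cell n x <= cell n c by rewrite le_floor// ler_wpM2r ?exprz_ge0// ltW.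
lia.
Qed.

Lemma exists_bound (n : int) (s : seq (dyadic * dyadic)) :
  exists M : nat, forall Q, Q \in s -> forall x y,
    cell Q.1.1 x = Q.1.2 -> cell Q.2.1 y = Q.2.2 ->
   (- M%:Z <= cell n x < M%:Z)%R /\ (- M%:Z <= cell n y < M%:Z)%R.
Proof.
elim: s => [|Q s [M IH]]; first by exists 0%N.
have [M1 h1] := dyadic_bounded n Q.1; have [M2 h2] := dyadic_bounded n Q.2.
exists (M + M1 + M2)%N => Q'; rewrite inE => /predU1P[->|/IH h] x y xQ yQ.
  by have := h1 _ xQ; have := h2 _ yQ; split; lia.
by have := h _ _ xQ yQ; lia.
Qed.

Lemma ip_indic_same (n a c : int) :
  ip mu \1_(dyadic_set R (n, a)) \1_(dyadic_set R (n,
    c)) = 2 ^ (- n) * (a == c)%:R.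
Proof.
have [->|ac] := eqVneq a c; first by rewrite ip_indic_sub// mulr1.
rewrite mulr0 -(ip0 mu \1_(dyadic_set R (n, c))); apply: eq_Rintegral => x _.
rewrite mul0r !indic_dyadic/=; have [->|] := eqVneq (cell n x) a;
  last by rewrite mul0r.
by rewrite (negbTE ac) mulr0.
Qed.

Lemma measurable_dyadic_open (U : set (R * R)) : dyadic_open U ->
  measurable (U : set (measurableTypeR R * measurableTypeR R)).
Proof.
move=> [s ->]; rewrite bigcup_seq; apply: bigsetU_measurable => Q _.
by apply: measurableX; exact: measurable_dyadic.
Qed.

(** Cut U into dyadic squares of one size and replace each factor 1_A by 1_A -
   1_A', where A' is a translate of A away from the origin, beyond the
   projections of U. The differences have finite Haar expansions, agree with
   1_A over U, stay orthogonal and have twice the squared norm; two variables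
   give the factor 4. *)
Lemma test_function (U : set (R * R)) : dyadic_open U ->
  exists s, (forall z, U z -> haar_sum s z = 1) /\
    ip pi (haar_sum s) (haar_sum s) = 4 * fine (pi U) /\ (pi U < +oo)%E.
Proof.
move=> oU; have [s0 eU] := oU; have [n nP] := exists_scale s0;
  have [M MP] := exists_bound n s0.
have UP x y : U (x, y) <-> exists2 Q, Q \in s0 & cell Q.1.1 x = Q.1.2 /\
  cell Q.2.1 y = Q.2.2.
  rewrite eU; split=> [[Q Qs [/= /dyadic_setP h1 /dyadic_setP h2]]|[Q Qs [h1
    h2]]]; exists Q => //.
  by split; apply/dyadic_setP.
(* p lists the generation n intervals meeting the projections of U; p'
   translates each by M, staying on its side of the origin but leaving that
   range. *)
pose p (i : 'I_(M + M)) : int := i%:Z - M%:Z.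
pose p' i : int := if 0 <= p i then p i + M%:Z else p i - M%:Z.
pose A i := \1_(dyadic_set R (n, p i)) : R -> R.
pose psi i x : R := A i x - \1_(dyadic_set R (n, p' i)) x.
have pr i : - M%:Z <= p i < M%:Z by rewrite /p; have := ltn_ord i; lia.
have p'r i : ~~ (- M%:Z <= p' i < M%:Z).
  by have := pr i; rewrite /p'; case: ifP; lia.
have pI i j : (p i == p j) = (i == j) by rewrite /p -val_eqE /=; lia.
have p'I i j : (p' i == p' j) = (i == j).
  have := pr i; have := pr j; rewrite -pI /p'.
  by case: ifP; case: ifP; lia.
have pp' i j : (p i == p' j) = false.
  by apply/negP => /eqP e; have := p'r j; rewrite -e pr.
have AL i : A i \in L2 by exact: indic_L2.
have psiE i : psi i = (fun x => -1 * \1_(dyadic_set R (n, p' i)) x + A i x).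
  by apply/funext => x; rewrite /psi; ring.
have psiL i : psi i \in L2 by rewrite psiE; apply: L2_lin => //;
  exact: indic_L2.
have Ao i j : ip mu (A i) (A j) = 2 ^ (- n) * (i == j)%:R.
  by rewrite ip_indic_same pI.
have psio i j : ip mu (psi i) (psi j) = 2 * 2 ^ (- n) * (i == j)%:R.
  have iL k := indic_L2 R (n, k).
  rewrite !psiE ip_linear ?L2_lin// ![ip mu _ (fun x =>
    _ + _)]ipC !ip_linear ?L2_lin//.
  rewrite !ip_indic_same !pI p'I ![p' _ == p _]eq_sym !pp' (eq_sym j).
  by rewrite /=; ring.
have psiS i : haar_comb xpredT (psi i).
  apply: indic_diff_comb; rewrite /same_side.
  by have := pr i; rewrite /p'; case: ifP; lia.
pose P (q : 'I_(M + M) * 'I_(M + M)) :=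
  `[< forall x y, cell n x = p q.1 -> cell n y = p q.2 -> U (x, y) >].
pose r := [seq q <- enum [set: 'I_(M + M) * 'I_(M + M)] | P q].
have ur : uniq r by rewrite filter_uniq// enum_uniq.
have val (phi : 'I_(M + M) -> R -> R) x y :
   (forall i, - M%:Z <= cell n x < M%:Z -> phi i x = (cell n x == p i)%:R) ->
   (forall i, - M%:Z <= cell n y < M%:Z -> phi i y = (cell n y == p i)%:R) ->
   U (x, y) -> \sum_(q <- r) 1 * tensor (phi q.1) (phi q.2) (x, y) = 1.
  move=> hx hy Uxy; have [Q Qs [xQ yQ]] := (UP x y).1 Uxy.
  have [cx cy] := MP Q Qs x y xQ yQ; have [n1 n2] := nP Q Qs.
  have [i ei] : exists i, cell n x = p i.
    have h : (absz (cell n x + M%:Z)%R < M + M)%N by lia.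
    by exists (Ordinal h); rewrite /p /=; lia.
  have [j ej] : exists j, cell n y = p j.
    have h : (absz (cell n y + M%:Z)%R < M + M)%N by lia.
    by exists (Ordinal h); rewrite /p /=; lia.
  have Pij : (i, j) \in r.
    rewrite mem_filter mem_enum in_setT andbT;
      apply/asboolP => x' y' /= ex' ey'.
    apply/UP; exists Q => //; rewrite -xQ -yQ.
    by split; [apply: cell_mono n1 _; rewrite ex' ei|apply: cell_mono n2 _;
      rewrite ey' ej].
  rewrite (bigD1_seq (i, j))//= big1 ?addr0.
    by rewrite /tensor/= hx// hy// ei ej !eqxx !mulr1.
  move=> [i' j']; rewrite xpair_eqE negb_and /tensor/= => h.
  rewrite hx// hy// ei ej !pI ![_ == i']eq_sym ![_ == j']eq_sym.
  by case/orP: h => /negbTE ->; rewrite /= ?(mulr0,mul0r).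
have [s es] : haar_spanned (fun z => \sum_(q <- r) 1 * tensor (psi q.1) (psi
  q.2) z).
  by apply: haar_spanned_sum => q; exact: haar_spanned_tensor (psiS _) (psiS _).
have [fL fn] := ip_orthogonal_tensors psiL psio ur.
have [gL gn] := ip_orthogonal_tensors AL Ao ur.
have UE : \1_U = (fun z => \sum_(q <- r) 1 * tensor (A q.1) (A q.2) z).
  apply/funext => -[x y]; rewrite indicE; case: (boolP ((x, y) \in U)) => Uxy.
    rewrite val//; [by move=> i _; rewrite /A indic_dyadic..|].
    by rewrite inE in Uxy.
  rewrite big_seq big1// => q; rewrite mem_filter => /andP[/asboolP Pq _].
  rewrite /tensor/A !indic_dyadic/=.
  have [e1|] := eqVneq (cell n x) (p q.1); last by rewrite mul0r mulr0.
  have [e2|] := eqVneq (cell n y) (p q.2); last by rewrite !mulr0.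
  by move/negP: Uxy; case; rewrite inE; exact: Pq.
have mU := measurable_dyadic_open oU.
have piU : pi U = (ip pi \1_U \1_U)%:E.
  rewrite -ip_EFin; last by rewrite UE.
  rewrite -[in LHS](setIT U) -integral_indic//; apply: eq_integral => z _.
  by rewrite indicE; case: (_ \in _); rewrite /= ?expr1n ?expr0n.
exists s; split; last first.
  by rewrite -es fn piU UE gn /= ltry; split => //; ring.
move=> [x y] Uxy; rewrite -es val//.
- by move=> i cx; rewrite /psi /A !indic_dyadic/= (_ : cell n x == p' i =
  false) ?subr0//;
   apply/negP => /eqP e; have := p'r i; rewrite -e cx.
- by move=> i cx; rewrite /psi /A !indic_dyadic/= (_ : cell n y == p' i =
  false) ?subr0//;
   apply/negP => /eqP e; have := p'r i; rewrite -e cx.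
Qed.

End test_function.

(** * The estimate *)

Section main.
Variable R : realType.
Local Notation mu := (@lebesgue_measure R).
Local Notation pi := (plane_measure R).
Local Notation L2 := (Lfun mu 2%:E).
Local Notation L2p := (Lfun pi 2%:E).
Local Notation haar_sum s := (tensor_sum s (@haar R) (@haar R)).
Variables (S : (R -> R) -> R -> R) (T1 T2 : (R * R -> R) -> R * R -> R).
Hypotheses (dS : dyadic_shift S) (aT1 : acting_in_x S T1) (aT2 : acting_in_y S
  T2).
Variable b : R * R -> R.
Hypothesis sb : symbol b.
Hypothesis eb : forall I J, haar_coef b I J <> 0 -> even_dyadic R I /\
  even_dyadic R J.

(** Bessel's inequality for the orthogonal family of shifted Haar tensors, each
   of squared norm 4, with coefficients 4 c times those of b. The factor c
   normalises the test function. *)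
Lemma finite_sum_le (X : seq (dyadic * dyadic)) s (c : R) : uniq X ->
  (forall Q, Q \in X -> forall x y, cell Q.1.1 x = Q.1.2 -> cell Q.2.1 y =
    Q.2.2 -> haar_sum s (x, y) = 1) ->
  4 * c ^+ 2 * (\sum_(Q <- X) haar_coef b Q.1 Q.2 ^+ 2) <=
  ip pi (repeated_commutator T1 T2 b (haar_sum [seq (c * t.1, t.2) | t <- s]))
        (repeated_commutator T1 T2 b (haar_sum [seq (c * t.1, t.2) | t <- s])).
Proof.
move=> uX hX; set g := haar_sum _.
pose ev (Q : dyadic * dyadic) := ~~ odd_dyadic Q.1 && ~~ odd_dyadic Q.2.
pose Y := [seq Q <- X | ev Q].
have uY : uniq Y by rewrite filter_uniq.
have YX Q : Q \in Y -> [/\ Q \in X, ~~ odd_dyadic Q.1 & ~~ odd_dyadic Q.2].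
  by rewrite mem_filter => /andP[/andP[]].
pose B (Q : dyadic * dyadic) := haar_coef b Q.1 Q.2.
have -> : \sum_(Q <- X) haar_coef b Q.1 Q.2 ^+ 2 = \sum_(Q <- Y) B Q ^+ 2.
  rewrite big_filter [RHS]big_mkcond; apply: eq_bigr => Q _; case: ifPn => //.
  rewrite negb_and !negbK => o; rewrite (haar_coef_odd eb o : haar_coef b Q.1
    Q.2 = 0).
  by rewrite expr0n.
set sig := \sum_(Q <- Y) _.
pose t (Q : dyadic * dyadic) : R * R -> R := tensor (haar_shift Q.1)
  (haar_shift Q.2).
have tL Q : t Q \in L2p by apply: tensor_L2; exact: haar_shift_L2.
pose G z := \sum_(Q <- Y) B Q * t Q z.
have [//|GL _] := @L2functional_sum _ _ _ pi _ _ Y B t (L2functional_ip (L2_0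
  pi)).
have lin h : h \in L2p -> ip pi G h = \sum_(Q <- Y) B Q * ip pi (t Q) h.
  by move=> hL; have [//|_ <-] := @L2functional_sum _ _ _ pi _ _ Y B t
    (L2functional_ip hL).
have GG : ip pi G G = 4 * sig.
  rewrite lin// mulr_sumr; apply: eq_big_seq => Q QY.
  have [_ o1 o2] := YX _ QY.
  rewrite ipC lin// (bigD1_seq Q)//= big1_seq ?addr0.
    by rewrite ip_tensor ?ip_haar_shift ?haar_shift_L2// !eqxx /=; ring.
  move=> Q' /andP[QQ' Q'Y].
  rewrite ip_tensor ?ip_haar_shift ?haar_shift_L2//.
  have [e1|_] := eqVneq Q'.1 Q.1; last by rewrite !(mulr0,mul0r).
  have [e2|_] := eqVneq Q'.2 Q.2; last by rewrite !(mulr0,mul0r).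
  by move: QQ'; rewrite [Q']surjective_pairing [Q]surjective_pairing e1 e2 eqxx.
have TL := repeated_commutator_L2 dS aT1 aT2 sb [seq (c * t.1, t.2) | t <- s].
have GT : ip pi G (repeated_commutator T1 T2 b g) = 4 * c * sig.
  rewrite lin// mulr_sumr; apply: eq_big_seq => Q QY.
  have [QX o1 o2] := YX _ QY.
  rewrite ipC (commutator_pairing dS aT1 aT2 sb)// big_map.
  have := commutator_coef sb eb dS aT1 aT2 o1 o2 (hX _ QX).
  rewrite (commutator_pairing dS aT1 aT2 sb)//.
  under [in X in _ -> X]eq_bigr do rewrite /= -mulrA.
  by rewrite -mulr_sumr => ->; rewrite -/(B Q); ring.
have := ip_cauchy_schwarz GL TL; rewrite GG GT.
set N := ip pi _ _ => H.
have s0 : 0 <= sig by apply: sumr_ge0 => Q _; exact: sqr_ge0.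
(* Cauchy-Schwarz reads (4 c sig)^2 <= 4 sig N, and sig can be cancelled once
   positive. *)
move: s0; rewrite le_eqVlt => /predU1P[<-|s0]; first by rewrite mulr0;
  exact: ip_ge0.
rewrite -(@ler_pM2r _ (4 * sig)) ?mulr_gt0// mulrC [leRHS]mulrC.
by apply: le_trans H; rewrite le_eqVlt; apply/orP; left; apply/eqP; ring.
Qed.

End main.

Theorem theorem9p1 (R : realType) :
  exists C1 C2 : R,
  forall (S : (R -> R) -> R -> R) (T1 T2 : (R * R -> R) -> R * R -> R),
  dyadic_shift S -> acting_in_x S T1 -> acting_in_y S T2 ->
  forall b : R * R -> R, symbol b ->
  (forall I J : dyadic, haar_coef b I J <> 0 ->
     even_dyadic R I /\ even_dyadic R J) ->
  forall U0 : set (R * R), dyadic_open U0 ->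
  (\esum_(Q in [set Q : dyadic * dyadic | (dyadic_rect R Q `<=` U0)%classic])
      (haar_coef b Q.1 Q.2 ^+ 2)%:E
   <= C1%:E * commutator_norm T1 T2 b ^+ 2 * plane_measure R U0
      + C2%:E * BMOr_norm_sq b * plane_measure R U0)%E.
Proof.
exists 1, 0 => S T1 T2 dS aT1 aT2 b sb eb U oU.
rewrite !mul0e adde0 mul1e.
have [s [s1 [sn Ufin]]] := test_function oU.
apply: ge_ereal_sup => _ [A [finA AU] <-].
rewrite fsbig_finite//=.
have : forall Q, Q \in finmap.enum_fset (fset_set A) -> A Q.
  by move=> Q h; apply/set_mem; rewrite -in_fset_set//; exact: h.
have : uniq (finmap.enum_fset (fset_set A)) by exact: finmap.fset_uniq.
move: (finmap.enum_fset _) => X uX XA.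
rewrite sumEFin.
(* A rectangle in X forces U to have positive measure, which is needed both to
   normalise the test function and to handle an infinite commutator norm. *)
case: (pselect (exists Q, Q \in X)) => [[Q0 Q0X]|nX]; last first.
  rewrite big_seq big1; last by move=> Q QX; case: nX; exists Q.
  by apply: mule_ge0 => //; exact: sqre_ge0.
have U0 : (0 < plane_measure R U)%E.
  have e : plane_measure R (dyadic_rect R Q0) =
      (@lebesgue_measure R (dyadic_set R Q0.1) * @lebesgue_measure R
        (dyadic_set R Q0.2))%E.
    by apply: product_measure1E; exact: measurable_dyadic.
  apply: (@lt_le_trans _ _ (plane_measure R (dyadic_rect R Q0))).
    by rewrite e !mu_dyadic -EFinM lte_fin mulr_gt0// dyadic_length_gt0.
  apply: le_measure; rewrite ?inE.
  - by apply: measurableX; exact: measurable_dyadic.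
  - exact: measurable_dyadic_open.
  - by apply: AU; exact: XA.
set N := commutator_norm T1 T2 b.
pose u := fine (plane_measure R U).
have uE : plane_measure R U = u%:E by rewrite fineK// ge0_fin_numE// ltW.
have u0 : 0 < u by rewrite -lte_fin -uE.
(* c scales the test function, of squared norm 4 u, to norm one. *)
pose c : R := (Num.sqrt (4 * u))^-1.
have u40 : 0 < 4 * u by rewrite mulr_gt0.
have c2 : c ^+ 2 * (4 * u) = 1.
  by rewrite exprVn sqr_sqrtr ?ltW// mulVf// gt_eqF.
pose g := tensor_sum [seq (c * t.1, t.2) | t <- s] (@haar R) (@haar R).
have gE : g = (fun z => c * tensor_sum s (@haar R) (@haar R) z).
  apply/funext => z; rewrite /g /tensor_sum big_map mulr_sumr.
  by apply: eq_bigr => t _ /=; rewrite mulrA.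
have sL := tensor_sum_L2 s (haar_L2 R) (haar_L2 R).
have gL : g \in Lfun (plane_measure R) 2%:E by rewrite gE; exact: L2_Z.
have gn : ('N[plane_measure R]_2%:E[EFin \o g] <= 1)%E.
  rewrite Lnorm_ip// gE ip_Z ?L2_Z// ipC ip_Z// sn -/u.
  by rewrite mulrA -expr2 c2 sqrtr1.
have TL := repeated_commutator_L2 dS aT1 aT2 sb [seq (c * t.1, t.2) | t <- s].
have NT : ('N[plane_measure R]_2%:E[EFin \o repeated_commutator T1 T2 b g] <=
  N)%E.
  apply: ereal_sup_ubound; exists g => //; split => //.
  by exists [seq (c * t.1, t.2) | t <- s].
rewrite Lnorm_ip// in NT.
have key : 4 * c ^+ 2 * (\sum_(Q <- X) haar_coef b Q.1 Q.2 ^+ 2) <=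
  ip (plane_measure R) (repeated_commutator T1 T2 b g) (repeated_commutator T1
    T2 b g).
  apply: (finite_sum_le dS aT1 aT2 sb eb (X := X) (s := s)) => //.
  move=> Q QX x y xQ yQ; apply: s1; apply: (AU _ (XA _ QX)).
  by split; apply/dyadic_setP.
rewrite uE; case: N NT => [r| |] // NT; last first.
  by rewrite [X in (_ <= X * _)%E](_ : _ = +oo%E) ?gt0_mulye ?leey ?lte_fin//;
    exact: mulyy.
rewrite -!EFinM lee_fin -expr2.
rewrite lee_fin in NT.
set W := ip _ _ _ in NT key.
have W0 : 0 <= W by exact: ip_ge0.
have Wr : W <= r ^+ 2.
  rewrite -[W]sqr_sqrtr// ler_pXn2r// ?nnegrE ?sqrtr_ge0//.
  by rewrite (le_trans _ NT)// sqrtr_ge0.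
have := le_trans key Wr; set sig := \sum_(_ <- _) _ => H.
have -> : sig = 4 * c ^+ 2 * sig * u.
  transitivity (c ^+ 2 * (4 * u) * sig); first by rewrite c2 mul1r.
  by ring.
by rewrite ler_pM2r.
Qed.
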